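(* The structure $(\mathbb{N},0,1,+,\times)$ is $\exists$-interpretable in $\mathcal{T}(\mathcal{L}_{\mathsf{BT}})$. Hence the existential theory of $\mathcal{T}(\mathcal{L}_{\mathsf{BT}})$ (the set of existential $\mathcal{L}_{\mathsf{BT}}$-sentences true in it) is undecidable.
   Context: Let $\mathbf{H}$ be the set of variable-free terms built from a constant $\perp$ and a binary function symbol $\langle\cdot,\cdot\rangle$. The substitution $t[r\mapsto s]$ is the term obtained by replacing each occurrence of $r$ in $t$ by $s$ (formally: $s$ if $t=r$; $\perp$ if $t\ne r$, $t=\perp$; $\langle t_1[r\mapsto s],t_2[r\mapsto s]\rangle$ if $t\ne r$, $t=\langle t_1,t_2\rangle$). $\mathcal{T}(\mathcal{L}_{\mathsf{BT}})=(\mathbf{H},\perp,\langle\cdot,\cdot\rangle,\cdot[\cdot\mapsto\cdot])$ in the language $\mathcal{L}_{\mathsf{BT}}=\{\perp,\langle\cdot,\cdot\rangle,\cdot[\cdot\mapsto\cdot]\}$. An existential formula is one built from atomic formulas and their negations using $\wedge,\vee$ and unbounded $\exists$. A structure $\mathfrak A$ in a finite language $\mathcal{L}_0$ is $\exists$-interpretable in a structure $\mathfrak B$ in a finite language $\mathcal{L}_1$ if there are parameter-free existential $\mathcal{L}_1$-formulas: $\delta(x)$ defining a nonempty subset $A'$ of the universe of $\mathfrak B$; for each constant $c$ of $\mathcal{L}_0$ a formula $\phi_c(x)$ defining a unique element of $A'$; for each $n$-ary function symbol $f$ a formula $\phi_f(x_1,\ldots,x_n,y)$ defining a function $(A')^n\to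 A'$; for each $n$-ary relation symbol $R$ formulas $\phi_R$, $\phi_{R^c}$ defining disjoint sets whose union is $(A')^n$; such that the resulting $\mathcal{L}_0$-structure on $A'$ is isomorphic to $\mathfrak A$. *)

(* Defs.v *)
From HB Require Import structures.
From mathcomp Require Import all_boot.

Set Implicit Arguments.
Unset Strict Implicit.
Unset Printing Implicit Defensive.

Record language := Language {
  cst : finType;
  fsym : finType;
  farity : fsym -> nat;
  rsym : finType;
  rarity : rsym -> nat }.

Record structure (L : language) (A : Type) := Structure {
  icst : cst L -> A;
  ifun : forall f : fsym L, ('I_(farity f) -> A) -> A;
  irel : forall r : rsym L, ('I_(rarity r) -> A) -> Prop }.

(* Formulas are well scoped: the variables of a [term L n], and the free
   variables of an [eform L n], are indexed by ['I_n]. *)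
Inductive term (L : language) (n : nat) : Type :=
| Var (i : 'I_n)
| Cst (c : cst L)
| App (f : fsym L) (args : 'I_(farity f) -> term L n).

Arguments Var {L n} i.
Arguments Cst {L n} c.
Arguments App {L n} f args.

(* [FEx] binds the variable [ord0] of its body; the free variable [i] of
   [FEx p] is the variable [lift ord0 i] of [p]. *)
Inductive eform (L : language) : nat -> Type :=
| FEq n (s t : term L n) : eform L n
| FNeq n (s t : term L n) : eform L n
| FRel n (r : rsym L) (args : 'I_(rarity r) -> term L n) : eform L n
| FNrel n (r : rsym L) (args : 'I_(rarity r) -> term L n) : eform L n
| FAnd n (p q : eform L n) : eform L n
| FOr n (p q : eform L n) : eform L n
| FEx n (p : eform L n.+1) : eform L n.

(* The tuple obtained from [v] by inserting [a] at position [k]. *)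
Definition insert (A : Type) (n : nat) (k : 'I_n.+1) (a : A) (v : 'I_n -> A) :
    'I_n.+1 -> A :=
  fun i => oapp v a (unlift k i).

Fixpoint teval (L : language) (A : Type) (M : structure L A) (n : nat)
    (v : 'I_n -> A) (t : term L n) {struct t} : A :=
  match t with
  | Var i => v i
  | Cst c => icst M c
  | App f args => ifun M (fun i => teval M v (args i))
  end.

Fixpoint sat (L : language) (A : Type) (M : structure L A) (n : nat)
    (p : eform L n) {struct p} : ('I_n -> A) -> Prop :=
  match p in eform _ m return ('I_m -> A) -> Prop with
  | FEq _ s t => fun v => teval M v s = teval M v t
  | FNeq _ s t => fun v => teval M v s <> teval M v t
  | FRel _ r args => fun v => irel M (fun i => teval M v (args i))
  | FNrel _ r args => fun v => ~ irel M (fun i => teval M v (args i))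
  | FAnd _ p q => fun v => sat M p v /\ sat M q v
  | FOr _ p q => fun v => sat M p v \/ sat M q v
  | FEx _ p => fun v => exists a : A, sat M p (insert ord0 a v)
  end.

Definition true_in (L : language) (A : Type) (M : structure L A)
    (p : eform L 0) : Prop :=
  forall v : 'I_0 -> A, sat M p v.

Definition isomorphic (L : language) (A B : Type)
    (M : structure L A) (N : structure L B) : Prop :=
  exists h : A -> B,
    [/\ bijective h,
        forall c : cst L, h (icst M c) = icst N c,
        forall (f : fsym L) (x : 'I_(farity f) -> A),
          h (ifun M x) = ifun N (fun i => h (x i))
      & forall (r : rsym L) (x : 'I_(rarity r) -> A),
          irel M x <-> irel N (fun i => h (x i))].

Definition defset (L : language) (B : Type) (N : structure L B)
    (delta : eform L 1) : Type :=
  {b : B | sat N delta (fun=> b)}.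

(* [phif f] has the arguments of [f] as its first variables and the value as
   its last one.  The sets defined by [phic], [phif], [phir], [phirc] are
   required to lie inside the powers of the set defined by [delta]. *)
Definition ex_interpretable (L0 L1 : language) (A B : Type)
    (M : structure L0 A) (N : structure L1 B) : Prop :=
  exists (delta : eform L1 1)
         (phic : cst L0 -> eform L1 1)
         (phif : forall f : fsym L0, eform L1 (farity f).+1)
         (phir phirc : forall r : rsym L0, eform L1 (rarity r)),
    inhabited (defset N delta) /\
    exists M' : structure L0 (defset N delta),
      [/\ forall (c : cst L0) (b : B),
            sat N (phic c) (fun=> b) <-> b = sval (icst M' c),
          forall (f : fsym L0) (v : 'I_(farity f) -> B) (y : B),
            sat N (phif f) (insert ord_max y v) <->
            exists x : 'I_(farity f) -> defset N delta,
              (forall i, v i = sval (x i)) /\ y = sval (ifun M' x),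
          forall (r : rsym L0) (v : 'I_(rarity r) -> B),
            ~ (sat N (phir r) v /\ sat N (phirc r) v) /\
            (sat N (phir r) v \/ sat N (phirc r) v <->
             forall i, sat N delta (fun=> v i)),
          forall (r : rsym L0) (x : 'I_(rarity r) -> defset N delta),
            irel M' x <-> sat N (phir r) (fun i => sval (x i))
        & isomorphic M M'].

Inductive recfun : nat -> Type :=
| RZero n : recfun n
| RSucc : recfun 1
| RProj n (i : 'I_n) : recfun n
| RComp k n (g : recfun k) (h : 'I_k -> recfun n) : recfun n
| RPrec n (g : recfun n) (h : recfun n.+2) : recfun n.+1
| RMu n (g : recfun n.+1) : recfun n.

(* [reval f x y]: the partial function [f] is defined at [x], with value [y].
   In [RPrec g h] the recursion variable comes first, and [h] takes the
   previous value, the predecessor of the recursion variable, and the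
   parameters, in this order. *)
Fixpoint reval (n : nat) (f : recfun n) {struct f} :
    ('I_n -> nat) -> nat -> Prop :=
  match f in recfun m return ('I_m -> nat) -> nat -> Prop with
  | RZero _ => fun _ y => y = 0
  | RSucc => fun x y => y = (x ord0).+1
  | RProj _ i => fun x y => y = x i
  | RComp k _ g h => fun x y =>
      exists z : 'I_k -> nat, (forall i, reval (h i) x (z i)) /\ reval g z y
  | RPrec _ g h => fun x y =>
      let p := fun i => x (lift ord0 i) in
      (fix iter (m y : nat) {struct m} : Prop :=
         match m with
         | 0 => reval g p y
         | m'.+1 => exists z : nat,
             iter m' z /\ reval h (insert ord0 z (insert ord0 m' p)) y
         end) (x ord0) y
  | RMu _ g => fun x y =>
      reval g (insert ord0 y x) 0 /\
      forall z : nat, z < y -> exists u : nat, reval g (insert ord0 z x) u.+1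
  end.

Definition decidable_set (S : nat -> Prop) : Prop :=
  exists f : recfun 1, forall n : nat,
    (S n -> reval f (fun=> n) 1) /\ (~ S n -> reval f (fun=> n) 0).

(* Cantor's pairing function. *)
Definition cpair (x y : nat) : nat := 'C((x + y).+1, 2) + x.

Fixpoint cseq (s : seq nat) : nat :=
  if s is x :: s' then (cpair x (cseq s')).+1 else 0.

Fixpoint tcode (L : language) (n : nat) (t : term L n) {struct t} : nat :=
  match t with
  | Var i => cseq [:: 0; val i]
  | Cst c => cseq [:: 1; val (enum_rank c)]
  | App f args =>
      cseq [:: 2, val (enum_rank f)
             & [seq tcode (args i) | i <- enum 'I_(farity f)]]
  end.

Fixpoint code (L : language) (n : nat) (p : eform L n) {struct p} : nat :=
  match p with
  | FEq _ s t => cseq [:: 0; tcode s; tcode t]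
  | FNeq _ s t => cseq [:: 1; tcode s; tcode t]
  | FRel _ r args =>
      cseq [:: 2, val (enum_rank r)
             & [seq tcode (args i) | i <- enum 'I_(rarity r)]]
  | FNrel _ r args =>
      cseq [:: 3, val (enum_rank r)
             & [seq tcode (args i) | i <- enum 'I_(rarity r)]]
  | FAnd _ p q => cseq [:: 4; code p; code q]
  | FOr _ p q => cseq [:: 5; code p; code q]
  | FEx _ p => cseq [:: 6; code p]
  end.

Definition decidable_ex_theory (L : language) (A : Type)
    (M : structure L A) : Prop :=
  decidable_set (fun n => exists p : eform L 0, true_in M p /\ code p = n).

Inductive nat_cst := NZero | NOne.

Definition bool_of_nat_cst (c : nat_cst) := if c is NZero then false else true.
Definition nat_cst_of_bool (b : bool) := if b then NOne else NZero.
Lemma bool_of_nat_cstK : cancel bool_of_nat_cst nat_cst_of_bool.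
Proof. by case. Qed.
HB.instance Definition _ := Finite.copy nat_cst (can_type bool_of_nat_cstK).

Inductive nat_fsym := NAdd | NMul.

Definition bool_of_nat_fsym (f : nat_fsym) := if f is NAdd then false else true.
Definition nat_fsym_of_bool (b : bool) := if b then NMul else NAdd.
Lemma bool_of_nat_fsymK : cancel bool_of_nat_fsym nat_fsym_of_bool.
Proof. by case. Qed.
HB.instance Definition _ := Finite.copy nat_fsym (can_type bool_of_nat_fsymK).

Definition nat_language : language :=
  @Language nat_cst nat_fsym (fun=> 2) void (fun=> 0).

Definition nat_structure : structure nat_language nat :=
  @Structure nat_language nat
    (fun c : nat_cst => match c with NZero => 0 | NOne => 1 end)
    (fun (f : nat_fsym) (x : 'I_2 -> nat) =>
       match f with
       | NAdd => x ord0 + x ord_max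
       | NMul => x ord0 * x ord_max
       end)
    (fun r : void => match r with end).

Inductive tree := Bot | Node (t1 t2 : tree).

Fixpoint tree_eqb (t u : tree) : bool :=
  match t, u with
  | Bot, Bot => true
  | Node t1 t2, Node u1 u2 => tree_eqb t1 u1 && tree_eqb t2 u2
  | _, _ => false
  end.

Lemma tree_eqbP : Equality.axiom tree_eqb.
Proof.
elim=> [|t1 IH1 t2 IH2] [|u1 u2] /=; try by constructor.
by apply: (iffP andP) => [[/IH1-> /IH2->]|[<- <-]] //; split; [apply/IH1|apply/IH2].
Qed.
HB.instance Definition _ := hasDecEq.Build tree tree_eqbP.

(* t[r |-> s] *)
Fixpoint tree_subst (t r s : tree) {struct t} : tree :=
  if t == r then s
  else match t with
       | Bot => Bot
       | Node t1 t2 => Node (tree_subst t1 r s) (tree_subst t2 r s)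
       end.

Inductive bt_fsym := BPair | BSubst.

Definition bool_of_bt_fsym (f : bt_fsym) := if f is BPair then false else true.
Definition bt_fsym_of_bool (b : bool) := if b then BSubst else BPair.
Lemma bool_of_bt_fsymK : cancel bool_of_bt_fsym bt_fsym_of_bool.
Proof. by case. Qed.
HB.instance Definition _ := Finite.copy bt_fsym (can_type bool_of_bt_fsymK).

Definition bt_arity (f : bt_fsym) : nat :=
  match f with BPair => 2 | BSubst => 3 end.

Definition bt_language : language :=
  @Language unit bt_fsym bt_arity void (fun=> 0).

Definition bt_fun (f : bt_fsym) : ('I_(bt_arity f) -> tree) -> tree :=
  match f with
  | BPair => fun x : 'I_2 -> tree => Node (x ord0) (x ord_max)
  | BSubst => fun x : 'I_3 -> tree =>
      tree_subst (x ord0) (x (@Ordinal 3 1 isT)) (x ord_max)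
  end.

Definition bt_structure : structure bt_language tree :=
  @Structure bt_language tree (fun=> Bot) bt_fun
    (fun r : void => match r with end).

(* Main.v *)
(* A queue automaton that reads one letter and writes one letter per step never
   changes the length of its queue, so a run is a word over its transitions such
   that the letters written, preceded by the initial queue, are the letters read,
   followed by the final queue, and the states chain up in the same way.  Coding
   words as right combs over pairwise incomparable letters, substitution of the
   end marker is concatenation and substitution of letters is letterwise
   renaming, so runs are existentially definable in the tree structure.  Queue
   automata simulate register machines, the queue being read as a multiset of
   registers, and register machines compute the recursive functions; so the
   graph of every recursive function is existentially definable on numerals,
   without a detour through Diophantine equations, and a decision procedure
   for existential sentences would refute itself by diagonalization.
   Multiplication is defined by the list of the pairs (j, x * j), which is
   shifted by one step by a simultaneous substitution. *)
Require Import Defs.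
From mathcomp Require Import all_boot.
From mathcomp Require Import zify.
From Stdlib Require Import FunctionalExtensionality ProofIrrelevance.

Set Implicit Arguments.
Unset Strict Implicit.
Unset Printing Implicit Defensive.

(** * Trees, letters and words *)

Fixpoint occurs (r t : tree) : bool :=
  (t == r) || (if t is Node t1 t2 then occurs r t1 || occurs r t2 else false).

Lemma occurs_refl t : occurs t t.
Proof. by case: t => [|t u] //=; rewrite eqxx. Qed.

Lemma occurs_node r t u :
  occurs r (Node t u) = [|| Node t u == r, occurs r t | occurs r u].
Proof. by []. Qed.

Lemma subst_self t s : tree_subst t t s = s.
Proof. by case: t => [|t u] //=; rewrite eqxx. Qed.

Lemma subst_node t u r s : Node t u != r ->
  tree_subst (Node t u) r s = Node (tree_subst t r s) (tree_subst u r s).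
Proof. by move=> /= /negbTE->. Qed.

Lemma subst_notin t r s : ~~ occurs r t -> tree_subst t r s = t.
Proof.
elim: t => [|t IHt u IHu] /=; first by case: eqP.
by case: eqP => //= _; rewrite negb_or => /andP[/IHt-> /IHu->].
Qed.

Lemma occurs_subst t r s : occurs r t -> occurs s (tree_subst t r s).
Proof.
elim: t => [|t IHt u IHu] /=.
  by case: eqP => // _ _; apply: occurs_refl.
case: (Node t u =P r) => [_ _|_ /= /orP[/IHt|/IHu] ->]; first exact: occurs_refl.
  by rewrite orbT.
by rewrite !orbT.
Qed.

Lemma occurs_trans r s t : occurs r s -> occurs s t -> occurs r t.
Proof.
move=> rs; elim: t => [|t IHt u IHu] /=.
  by rewrite orbF => /eqP e; move: rs; rewrite -e.
case/orP => [/eqP e|]; first by rewrite -e in rs.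
by case/orP => [/IHt|/IHu] ->; rewrite !orbT.
Qed.

(** Any replacement would leave a copy of [s] in the result, so a result free of [s] shows that
    nothing was replaced. This is how unknown trees are recovered from their images. *)
Lemma subst_inv t r s p : ~~ occurs s p -> tree_subst t r s = p -> t = p.
Proof.
move=> sp tp; rewrite -tp subst_notin //; apply: contra sp => rt.
by rewrite -tp occurs_subst.
Qed.

Fixpoint comb n := if n is n'.+1 then Node Bot (comb n') else Node Bot Bot.

(* The trees [letter i] do not occur in one another, so that substituting for
   a letter never interferes with the other letters. *)
Definition letter i := Node (comb i) Bot.

Lemma comb_inj : injective comb.
Proof. by elim=> [|m IH] [|n] //= []; [case: n|case: m {IH}|move/IH->]. Qed.

Lemma letter_inj : injective letter.
Proof. by move=> i j [] /comb_inj. Qed.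

Lemma letter_eq i j : (letter i == letter j) = (i == j).
Proof. by rewrite (inj_eq letter_inj). Qed.

Lemma comb_letter i j : comb i <> letter j.
Proof. by case: i => [|i] [] //; case: j. Qed.

(** A nonempty word is therefore not a letter, and substituting for a letter always descends along
    its spine. *)
Lemma node_letter i t j : Node (letter i) t <> letter j.
Proof. by case=> e _; case: (@comb_letter j i). Qed.

Lemma occurs_comb i j : occurs (letter i) (comb j) = false.
Proof.
have ne k : (comb k == letter i) = false by apply/eqP/comb_letter.
elim: j => [|j IH]; first by rewrite [LHS]/= -/(comb 0) ne.
by rewrite [LHS]/= -/(comb j.+1) ne IH.
Qed.

Lemma occurs_letter i j : occurs (letter i) (letter j) = (i == j).
Proof. by rewrite [LHS]/= -/(letter j) occurs_comb letter_eq !orbF eq_sym. Qed.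

Lemma subst_letter i j s :
  tree_subst (letter i) (letter j) s = if i == j then s else letter i.
Proof.
case: eqP => [->|/eqP ne]; first exact: subst_self.
by rewrite subst_notin // occurs_letter eq_sym.
Qed.

Definition wcat w t := foldr (fun i => Node (letter i)) t w.
Definition word w := wcat w (letter 0).
Definition num n := word (nseq n 1).

Lemma occurs_wcat i w t :
  occurs (letter i) (wcat w t) = (i \in w) || occurs (letter i) t.
Proof.
elim: w => // k w IH; rewrite [LHS]occurs_node occurs_letter IH inE -orbA.
by have /eqP/negbTE-> := @node_letter k (wcat w t) i.
Qed.

Lemma wcat_cat v w t : wcat (v ++ w) t = wcat v (wcat w t).
Proof. by rewrite /wcat foldr_cat. Qed.

Lemma subst_wcons i t j s : tree_subst (Node (letter i) t) (letter j) s =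
  Node (if i == j then s else letter i) (tree_subst t (letter j) s).
Proof. by rewrite subst_node ?subst_letter //; apply/eqP/node_letter. Qed.

Lemma subst_wcat i w t s : i \notin w ->
  tree_subst (wcat w t) (letter i) s = wcat w (tree_subst t (letter i) s).
Proof.
elim: w => // k w IH; rewrite inE negb_or => /andP[ik /IH e].
by rewrite [LHS]subst_wcons e eq_sym (negbTE ik).
Qed.

Lemma subst_word_end w s : 0 \notin w -> tree_subst (word w) (letter 0) s = wcat w s.
Proof. by move=> w0; rewrite subst_wcat // subst_self. Qed.

Lemma subst_word_letter w i j : i != 0 ->
  tree_subst (word w) (letter i) (letter j) =
  word [seq if k == i then j else k | k <- w].
Proof.
move=> i0; elim: w => [|k w IH]; first by rewrite [LHS]subst_letter eq_sym (negbTE i0).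
by rewrite [LHS]subst_wcons IH /=; case: eqP.
Qed.

Lemma word_inj : injective word.
Proof.
elim=> [|i v IH] [|j w] //.
- by move=> /esym/node_letter.
- by move/node_letter.
- by case=> /comb_inj-> /IH->.
Qed.

(** A prefix can be cancelled even before an unknown tail: the end marker is not of the form
    [Node (letter i) t], so the spines agree letter by letter. *)
Lemma word_wcat s w t : word s = wcat w t -> exists2 u, s = w ++ u & t = word u.
Proof.
elim: w s => [|i w IH] [|j s] //=; try by move<-; eexists.
- by move/esym/node_letter.
- by case=> /comb_inj-> /IH[u -> ->]; exists u.
Qed.

(** If [j] differs from [k], nothing was inserted. Otherwise the whole tree was replaced, or its
    children become a comb and [Bot], neither of which contains a letter. *)
Lemma subst_letter_inv t i j k : tree_subst t (letter i) (letter j) = letter k ->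
  t = letter i /\ j = k \/ t = letter k.
Proof.
case: (eqVneq j k) => [<-|jk]; last first.
  by move=> e; right; apply: subst_inv e; rewrite occurs_letter.
case: (eqVneq t (letter i)) => [->|]; first by left.
case: t => [//|t u] ne; rewrite subst_node // => -[e1 e2]; right.
by congr Node; [apply: subst_inv e1|apply: subst_inv e2]; rewrite ?occurs_comb.
Qed.

(** Since [j != 0], the end marker of the image was not inserted, and no nonempty suffix of the
    image is a letter; so the spine of [t] is intact and only letters on it were renamed. *)
Lemma subst_word_inv t i j w : j != 0 -> tree_subst t (letter i) (letter j) = word w ->
  exists2 v, t = word v & w = [seq if k == i then j else k | k <- v].
Proof.
move=> j0; elim: w t => [|k w IH] t e.
  exists [::] => //; apply: subst_inv e.
  by rewrite occurs_letter.
have ne : t != letter i.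
  by apply: contra_eqN e => /eqP->; rewrite subst_self; apply/eqP => /esym/node_letter.
case: t ne e => [//|t u] ne; rewrite subst_node // => -[e1 /IH[v -> ->]].
have [[-> <-]|tk] := subst_letter_inv e1; first by exists (i :: v); rewrite //= eqxx.
exists (k :: v); rewrite tk // in e1 *.
rewrite /=; case: eqP e1 => // ->.
by rewrite subst_self => /letter_inj->.
Qed.

(** * Multiplication of numerals *)

Lemma notin_nseq (i n a : nat) : i != a -> i \notin nseq n a.
Proof. by rewrite mem_nseq => /negbTE->; rewrite andbF. Qed.

(** Read on words, the equation says that appending [a] to [t] is the same as prepending it, which
    forces a power of [a]. The induction shows that trees which are not words give no further
    solutions. *)
Lemma unaryP a t : a != 0 ->
  tree_subst t (letter 0) (Node (letter a) (letter 0)) = Node (letter a) t <->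
  exists n, t = word (nseq n a).
Proof.
move=> a0; split=> [|[n ->]]; last first.
  rewrite subst_word_end ?notin_nseq 1?eq_sym //.
  by rewrite -[Node _ (letter 0)]/(wcat (nseq 1 a) (letter 0)) -wcat_cat -nseqD addn1.
elim: t => [//|t _ u IH].
case: (eqVneq (Node t u) (letter 0)) => [-> _|ne]; first by exists 0.
rewrite subst_node // => -[et eu].
(* The inserted tree contains [letter 0], which does not occur in [letter a], so nothing was
   replaced in [t]. *)
have ta : t = letter a.
  apply: subst_inv et; apply/negP => /(@occurs_trans (letter 0)).
  by rewrite occurs_letter eq_sym (negbTE a0) occurs_node occurs_refl !orbT => /(_ isT).
rewrite ta in eu *; have [n ->] := IH eu; by exists n.+1.
Qed.

Lemma num_wordP t : tree_subst t (letter 0) (num 1) = Node (letter 1) t <->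
  exists n, t = num n.
Proof. exact: unaryP. Qed.

Lemma num_inj : injective num.
Proof. by move=> m n /word_inj e; rewrite -(size_nseq m 1) e size_nseq. Qed.

Lemma num_comb n i : num n <> comb i.
Proof. by case: n => [|n] /esym; [apply: comb_letter|case: i => [|i] []]. Qed.

Section Multiplication.

Variable x : nat.

(** The two components of a pair end in different markers, [letter 0] and [letter 2]. Hence [shift],
    by one substitution for each marker, adds 1 to all first components and [x] to all second
    components of a list of pairs. *)
Let pt j := Node (num j) (wcat (nseq (x * j) 1) (letter 2)).
Let shift t := tree_subst (tree_subst t (letter 0) (num 1)) (letter 2)
  (tree_subst (num x) (letter 0) (letter 2)).

Let num2 n : tree_subst (num n) (letter 0) (letter 2) = wcat (nseq n 1) (letter 2).
Proof. by rewrite subst_word_end ?notin_nseq. Qed.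

Let num_S j : tree_subst (num j) (letter 0) (num 1) = num j.+1.
Proof. by rewrite subst_word_end ?notin_nseq // -wcat_cat -nseqD addn1. Qed.

Let node_num j t i : Node (num j) t != letter i.
Proof. by apply/eqP => -[/num_comb]. Qed.

Let node_node t u v i : t <> Bot -> Node (Node t u) v != letter i.
Proof. by move=> t0; apply/eqP; case: i => [|i] []. Qed.

Let num0 j : num j <> Bot. Proof. by case: j. Qed.

Let pt_S j : tree_subst (pt j) (letter 0) (num 1) =
  Node (num j.+1) (wcat (nseq (x * j) 1) (letter 2)).
Proof. by rewrite subst_node // num_S subst_wcat ?notin_nseq // subst_letter. Qed.

Let shift_pt j : shift (pt j) = pt j.+1.
Proof.
rewrite /shift pt_S num2 subst_node // !subst_wcat ?notin_nseq // subst_self.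
by rewrite subst_letter /pt mulnS -wcat_cat -nseqD [_ + x]addnC.
Qed.

Let shift_cons j t : shift (Node (pt j) t) = Node (pt j.+1) (shift t).
Proof.
by rewrite -shift_pt /shift subst_node ?node_node // pt_S subst_node ?node_node.
Qed.

Let pt3 j : ~~ occurs (letter 3) (pt j).
Proof.
rewrite occurs_node !occurs_wcat !occurs_letter !mem_nseq !andbF !orbF.
exact: node_num.
Qed.

(** The intended [L] lists [pt 0] to [pt y.-1] and ends in [letter 3]; prepending [pt 0] to its
    shift is then the same as appending [pt y]. Conversely, the equation forces the appended pair to
    be some [pt k], and its first component gives [k = y]. *)
Lemma mulP y z : (exists L, Node (Node (letter 0) (letter 2)) (shift L) =
    tree_subst L (letter 3)
      (Node (Node (num y) (tree_subst (num z) (letter 0) (letter 2))) (letter 3)))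
  <-> z = x * y.
Proof.
rewrite num2; set q := Node (num y) _.
have -> : Node (letter 0) (letter 2) = pt 0 by rewrite /pt muln0.
have sh3 : shift (letter 3) = letter 3 by rewrite /shift !subst_letter.
have pne j t i : Node (pt j) t != letter i by rewrite node_node.
split=> [[L]|zxy]; last first.
  (* The list may start at any [pt j], so that the induction on [y] can add an element in front. *)
  suff /(_ 0) : forall j, exists L, Node (pt j) (shift L) =
      tree_subst L (letter 3) (Node (pt (j + y)) (letter 3)).
    by rewrite /q zxy.
  elim: y {q zxy} => [|y IH] j.
    by exists (letter 3); rewrite sh3 subst_self addn0.
  have [L eL] := IH j.+1; exists (Node (pt j) L).
  by rewrite shift_cons eL addnS -addSn subst_node // (subst_notin _ (pt3 j)).
(* Down the spine of [L], each head must be the next [pt j], because [letter 3] does not occur in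
   [pt j]; when the marker [letter 3] is reached, the equation identifies [q] with the current
   pair. *)
suff inv L' : forall j, Node (pt j) (shift L') =
    tree_subst L' (letter 3) (Node q (letter 3)) -> exists k, q = pt k.
  move/inv => [k]; rewrite /q /pt => -[/num_inj yk]; rewrite -yk.
  move=> /(congr1 (fun t => tree_subst t (letter 2) (letter 0))).
  by rewrite !subst_wcat ?notin_nseq // !subst_self => /num_inj.
elim: L' => [//|u _ v IH] j.
have [->|ne] := eqVneq (Node u v) (letter 3).
  rewrite sh3 subst_self => /(congr1 (fun t => if t is Node a _ then a else t)) /= e.
  by exists j.
rewrite subst_node // => e.
have eu := congr1 (fun t => if t is Node a _ then a else t) e.
have ev := congr1 (fun t => if t is Node _ b then b else t) e.
have upt : u = pt j.
  apply: (subst_inv (r := letter 3)) (esym eu); apply: contra (pt3 j).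
  by apply: occurs_trans; rewrite occurs_node occurs_refl !orbT.
by rewrite upt shift_cons in ev; apply: IH ev.
Qed.

End Multiplication.

(** * Existentially definable relations *)

Definition definable n (R : ('I_n -> tree) -> Prop) :=
  exists p : eform bt_language n, forall v, sat bt_structure p v <-> R v.

Definition term_definable n (F : ('I_n -> tree) -> tree) :=
  exists t : term bt_language n, forall v, teval bt_structure v t = F v.

Lemma definable_ext n (R R' : ('I_n -> tree) -> Prop) :
  (forall v, R v <-> R' v) -> definable R -> definable R'.
Proof. by move=> RR' [p pP]; exists p => v; rewrite pP. Qed.

Lemma definable_and n (R R' : ('I_n -> tree) -> Prop) :
  definable R -> definable R' -> definable (fun v => R v /\ R' v).
Proof. by move=> [p pP] [q qP]; exists (FAnd p q) => v /=; rewrite pP qP. Qed.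

Lemma definable_eq n (F G : ('I_n -> tree) -> tree) :
  term_definable F -> term_definable G -> definable (fun v => F v = G v).
Proof. by move=> [s sP] [t tP]; exists (FEq s t) => v /=; rewrite sP tP. Qed.

Lemma insert_ord0 A n (a : A) (v : 'I_n -> A) : insert ord0 a v ord0 = a.
Proof. by rewrite /insert unlift_none. Qed.

Lemma insert_lift A n k (a : A) (v : 'I_n -> A) i : insert k a v (lift k i) = v i.
Proof. by rewrite /insert liftK. Qed.

Lemma definable_ex n (Q : tree -> ('I_n -> tree) -> Prop) :
  definable (fun w : 'I_n.+1 -> tree => Q (w ord0) (fun i => w (lift ord0 i))) ->
  definable (fun v => exists a, Q a v).
Proof.
move=> [p pP]; exists (FEx p) => v /=.
have ins a : sat bt_structure p (insert ord0 a v) <-> Q a v.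
  rewrite pP insert_ord0.
  suff -> : (fun i => insert ord0 a v (lift ord0 i)) = v by [].
  by apply: functional_extensionality => i; rewrite insert_lift.
by split=> -[a /ins]; exists a.
Qed.

Definition node_term n (t u : term bt_language n) : term bt_language n :=
  @App bt_language n BPair (fun i : 'I_2 => nth t [:: t; u] i).

Definition subst_term n (t r s : term bt_language n) : term bt_language n :=
  @App bt_language n BSubst (fun i : 'I_3 => nth t [:: t; r; s] i).

Fixpoint tree_term n (t : tree) : term bt_language n :=
  if t is Node t1 t2 then node_term (tree_term n t1) (tree_term n t2)
  else @Cst bt_language n tt.

Lemma teval_tree_term n t v : teval bt_structure v (tree_term n t) = t.
Proof. by elim: t => //= t -> u ->. Qed.

Lemma term_definable_var n (i : 'I_n) : term_definable (fun v => v i).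
Proof. by exists (Var i). Qed.

Lemma term_definable_cst n t : term_definable (fun _ : 'I_n -> tree => t).
Proof. by exists (tree_term n t) => v; apply: teval_tree_term. Qed.

Lemma term_definable_node n (F G : ('I_n -> tree) -> tree) :
  term_definable F -> term_definable G -> term_definable (fun v => Node (F v) (G v)).
Proof. by move=> [s sP] [t tP]; exists (node_term s t) => v /=; rewrite sP tP. Qed.

Lemma term_definable_subst n (F G H : ('I_n -> tree) -> tree) :
  term_definable F -> term_definable G -> term_definable H ->
  term_definable (fun v => tree_subst (F v) (G v) (H v)).
Proof.
move=> [r rP] [s sP] [t tP]; exists (subst_term r s t) => v.
by rewrite -rP -sP -tP.
Qed.

Ltac solve_definable :=
  repeat first
    [ apply: definable_ex | apply: definable_and | apply: definable_eq
    | apply: term_definable_cst | apply: term_definable_var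
    | apply: term_definable_node | apply: term_definable_subst ].

(** * Numerals and the arithmetical operations *)

Definition is_num t := tree_subst t (letter 0) (num 1) = Node (letter 1) t.

Lemma definable_num n (F : ('I_n -> tree) -> tree) :
  term_definable F -> definable (fun v => is_num (F v)).
Proof. by move=> FP; rewrite /is_num; solve_definable. Qed.

(** The end marker [letter 0] has the form [Node _ Bot] and counts as 0. On trees that are not
    numerals the value is arbitrary, so [is_num] guards every use. *)
Fixpoint num_val t := if t is Node _ u then if u is Bot then 0 else (num_val u).+1 else 0.

Lemma numK : cancel num num_val.
Proof. by elim=> [//|[//|n] IH]; rewrite -[in RHS]IH. Qed.

Lemma is_numP t : is_num t <-> t = num (num_val t).
Proof.
rewrite /is_num num_wordP; split=> [[n ->]|->]; first by rewrite numK.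
by eexists.
Qed.

Definition nat_op (f : nat_fsym) := if f is NAdd then addn else muln.

Lemma nat_opE f (u : 'I_2 -> nat) :
  nat_op f (u ord0) (u ord_max) = @ifun nat_language _ nat_structure f u.
Proof. by case: f. Qed.

(** Addition is concatenation of numerals, and multiplication is the equation of [mulP] with the
    list [L] quantified existentially; neither mentions [num_val]. *)
Lemma definable_op f : definable (fun v : 'I_3 -> tree =>
  is_num (v ord0) /\ is_num (v (@Ordinal 3 1 isT)) /\
  v ord_max = num (nat_op f (num_val (v ord0)) (num_val (v (@Ordinal 3 1 isT))))).
Proof.
case: f.
  apply: (@definable_ext _ (fun v => is_num (v ord0) /\ is_num (v (@Ordinal 3 1 isT)) /\
      tree_subst (v ord0) (letter 0) (v (@Ordinal 3 1 isT)) = v ord_max)).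
    move=> v; rewrite !is_numP; split=> [[-> [-> <-]]|[-> [-> ->]]].
      by rewrite !numK; split=> //; rewrite subst_word_end ?notin_nseq // -wcat_cat -nseqD.
    by rewrite !numK; do !split=> //; rewrite subst_word_end ?notin_nseq // -wcat_cat -nseqD.
  by do !apply: definable_and; try apply: definable_num; solve_definable.
apply: (@definable_ext _ (fun v => is_num (v ord0) /\ is_num (v (@Ordinal 3 1 isT)) /\
   is_num (v ord_max) /\
   exists L, Node (Node (letter 0) (letter 2)) (tree_subst
       (tree_subst L (letter 0) (num 1)) (letter 2)
       (tree_subst (v ord0) (letter 0) (letter 2))) =
     tree_subst L (letter 3) (Node (Node (v (@Ordinal 3 1 isT))
       (tree_subst (v ord_max) (letter 0) (letter 2))) (letter 3)))).
  move=> v; rewrite !is_numP; split=> [[-> [-> [-> /mulP zxy]]]|[-> [-> ->]]].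
    by rewrite !numK zxy.
  by rewrite !numK; do !split=> //; apply/mulP.
by do !apply: definable_and; try apply: definable_num; solve_definable.
Qed.

Theorem nat_interpretable : ex_interpretable nat_structure bt_structure.
Proof.
have [delta deltaP] := definable_num (term_definable_var (@ord0 0)).
have cstP (c : nat_cst) :
    definable (fun v : 'I_1 -> tree => v ord0 = num (icst nat_structure c)).
  by solve_definable.
have /(fin_all_exists (T := nat_cst)) [phic phicP] := cstP.
have /(fin_all_exists (T := nat_fsym)) [phif phifP] := definable_op.
have deltaE b : sat bt_structure delta (fun=> b) <-> b = num (num_val b).
  by rewrite deltaP is_numP.
have numD n : sat bt_structure delta (fun=> num n) by apply/deltaE; rewrite numK.
pose enc n : defset bt_structure delta := exist _ (num n) (numD n).
pose dec (d : defset bt_structure delta) := num_val (sval d).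
have encK : cancel enc dec by move=> n; apply: numK.
have decK : cancel dec enc.
  move=> [b bD]; have e : b = num (num_val b) by apply/deltaE.
  rewrite /enc /dec /=; move: (numD _); rewrite -e => bD'.
  by congr exist; apply: proof_irrelevance.
pose M' : structure nat_language (defset bt_structure delta) :=
  @Structure nat_language _ (fun c => enc (icst nat_structure c))
    (fun f x => enc (ifun nat_structure (fun i => dec (x i))))
    (fun r : void => match r with end).
exists delta, phic, phif, (fun r : void => match r with end),
  (fun r : void => match r with end).
split; first exact: inhabits (enc 0).
exists M'; split=> [c b|f v y|[]|[]|] //.
  have [v0 v1] : @insert _ 2 ord_max y v ord0 = v ord0 /\
      @insert _ 2 ord_max y v (@Ordinal 3 1 isT) = v ord_max.
    by split; rewrite -(insert_lift ord_max y v); congr insert; apply: val_inj.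
  have vm : @insert _ 2 ord_max y v ord_max = y by rewrite /insert unlift_none.
  rewrite phifP v0 v1 vm; split=> [[/is_numP n0 [/is_numP n1 ey]]|[x [vx ->]]].
    have vD (i : 'I_2) : sat bt_structure delta (fun=> v i).
      apply/deltaE; have : (i == ord0) || (i == ord_max) by case: i => -[|[]].
      by case/orP => /eqP->.
    exists (fun i => exist _ (v i) (vD i)); split=> //.
    by rewrite ey (nat_opE f (fun i => num_val (v i))).
  rewrite !vx !is_numP; split; last split; try by apply/deltaE; case: (x _).
  exact: (congr1 num (esym (nat_opE f (fun i => dec (x i))))).
exists enc; split=> [|//|f x|[]]; first by exists dec.
by congr enc; congr ifun; apply: functional_extensionality => i; rewrite encK.
Qed.

(** * Queue automata *)

(** A simultaneous renaming has to be expressed by successive substitutions. The shift from [i] to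
    [i.+1] spares the end marker. *)
Definition recode (F : nat -> nat) l t :=
  foldl (fun t i => tree_subst t (letter i.+1) (letter (F i))) t l.

Definition recode_letter (F : nat -> nat) l k :=
  foldl (fun k i => if k == i.+1 then F i else k) k l.

Lemma recode_word F l w : recode F l (word w) = word (map (recode_letter F l) w).
Proof.
elim: l w => [|i l IH] w /=; first by rewrite map_id.
by rewrite subst_word_letter // IH -map_comp.
Qed.

Lemma recode_word_inv F l t w : (forall i, F i != 0) -> recode F l t = word w ->
  exists2 v, t = word v & w = map (recode_letter F l) v.
Proof.
move=> F0; elim: l t => [|i l IH] t /=; first by move=> ->; exists w; rewrite ?map_id.
move=> /IH[v /subst_word_inv[//|v' -> ->] ->].
by exists v'; rewrite // -map_comp.
Qed.

(** The successive substitutions act as a simultaneous one when each image that falls in the renamed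
    range is a fixed letter, so that renaming it again is harmless. *)
Lemma recode_letter_iota F m n k :
  (forall i, m < F i <= m + n -> F (F i).-1 = F i) ->
  recode_letter F (iota m n) k = if m < k <= m + n then F k.-1 else k.
Proof.
elim: n m k => [|n IH] m k FF /=.
  by rewrite addn0; case: ifP => //; lia.
rewrite -/(recode_letter F (iota m.+1 n) _) IH => [|i Fi]; last by apply: FF; lia.
case: eqP => [->|ne].
  case: ifP => [Fm|_]; first by rewrite FF; [case: ifP => //; lia|lia].
  by case: ifP => //; lia.
by case: ifP; case: ifP => //; lia.
Qed.

Lemma term_definable_recode F l n (G : ('I_n -> tree) -> tree) :
  term_definable G -> term_definable (fun v => recode F l (G v)).
Proof.
elim: l G => //= i l IH G GP; apply: (IH (fun v => tree_subst (G v) _ _)).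
by solve_definable.
Qed.

(* A transition [(p, a, b, q)] goes from state [p] to state [q], removing [a]
   from the front of the queue and appending [b] at its end. *)
Definition transition := (nat * nat * nat * nat)%type.
Definition src (t : transition) := t.1.1.1.
Definition rd (t : transition) := t.1.1.2.
Definition wr (t : transition) := t.1.2.
Definition dst (t : transition) := t.2.

Inductive qrun (D : seq transition) : nat -> seq nat -> nat -> seq nat -> Prop :=
| QStop p u : qrun D p u p u
| QStep p a b p' u q u' : (p, a, b, p') \in D ->
    qrun D p' (rcons u b) q u' -> qrun D p (a :: u) q u'.

(* A nonempty queue never becomes empty, so its successive contents are
   the factors of a single word, written on one side and read on the other. *)
Lemma qrunP D p u q : u != [::] ->
  (exists u', qrun D p u q u') <->
  exists z, [/\ {subset z <= D}, p :: map dst z = rcons (map src z) q &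
    exists u', u ++ map wr z = map rd z ++ u'].
Proof.
move=> u0; split=> [[u' run]|[z [zD chain [u' e]]]].
  elim: run {u0} => {p u q u'} [p u|p a b p' u q u' tD run [z [zD chain [v e]]]].
    by exists [::]; split=> //; exists u; rewrite cats0.
  exists ((p, a, b, p') :: z); split.
  - by move=> t; rewrite inE => /orP[/eqP->|/zD].
  - by rewrite /= chain.
  - by exists v; rewrite /= -e cat_rcons.
elim: z p u u0 zD chain e => [|[[[p0 a] b] p'] z IH] p u u0 zD /=.
  by case=> -> _; exists u; constructor.
case: u u0 => //= a' u _ [-> chain] [-> e].
have [|||v run] := IH p' (rcons u b) _ _ chain.
- by rewrite -size_eq0 size_rcons.
- by move=> t tz; apply: zD; rewrite inE tz orbT.
- by rewrite cat_rcons.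
by exists v; apply: QStep run; apply: zD; rewrite inE eqxx.
Qed.

Section QueueDefinable.

Variables (D : seq transition) (p q A B F : nat).
Hypothesis D0 : D != [::].

Let N := size D.
(** Letters 1 to [N] name the transitions of [D]. States and queue symbols are moved beyond [N], so
    that renaming a transition to one of its components never yields another transition letter. *)
Let tgt c := letter (N.+1 + c).
Let view f i := N.+1 + f (nth (0, 0, 0, 0) D i).
Let proj f := recode (view f) (iota 0 N).

Let g c := N.+1 + c.
Let gK : cancel g (subn^~ N.+1).
Proof. by move=> c; rewrite /g addKn. Qed.

Let notin0 s : 0 \notin map g s.
Proof. by apply/mapP => -[]. Qed.

Let proj_word f w : all (fun k => 0 < k <= N) w ->
  proj f (word w) = word (map g (map f [seq nth (0, 0, 0, 0) D k.-1 | k <- w])).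
Proof.
move=> wN; rewrite /proj recode_word -!map_comp; congr word.
apply/eq_in_map => k /(allP wN) kN.
by rewrite recode_letter_iota => [|i]; rewrite ?kN // /view; lia.
Qed.

Let chainP X Y : Node (tgt p) (word (map g X)) =
    tree_subst (word (map g Y)) (letter 0) (Node (tgt q) (letter 0)) <->
  p :: X = rcons Y q.
Proof.
rewrite subst_word_end ?notin0 // -[RHS]/(wcat _ (wcat [:: g q] (letter 0))) -wcat_cat cats1.
rewrite -[Node _ _]/(word (map g (p :: X))) -map_rcons.
by split=> [/word_inj/(inj_map (can_inj gK))|->].
Qed.

(** The initial queue is built from [num n] by renaming 1 to [A] and replacing the end marker by the
    blanks. The tree [c] is unknown, but cancelling the read letters makes it a word over shifted
    letters. *)
Let shiftP n m X Y c : tree_subst (Node (tgt F) (tree_subst (tree_subst (num n) (letter 1)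
      (tgt A)) (letter 0) (word (nseq m (g B))))) (letter 0) (word (map g X)) =
    tree_subst (word (map g Y)) (letter 0) c <->
  exists2 u, (F :: nseq n A ++ nseq m B) ++ X = Y ++ u & c = word (map g u).
Proof.
rewrite subst_word_letter // map_nseq eqxx -/(g A) -[nseq n (g A)]map_nseq -[nseq m _]map_nseq.
rewrite subst_word_end ?notin0 // -wcat_cat -map_cat.
rewrite -[Node _ _]/(word (map g (F :: nseq n A ++ nseq m B))).
rewrite !subst_word_end ?notin0 // -wcat_cat -map_cat; split=> [/word_wcat[u e ->]|[u -> ->]].
  have := congr1 (map (subn^~ N.+1)) e; rewrite (mapK gK) map_cat (mapK gK) => e'.
  exists (map (subn^~ N.+1) u) => //; congr word.
  by move: e; rewrite e' map_cat => /eqP; rewrite eqseq_cat // eqxx => /eqP.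
by rewrite map_cat wcat_cat.
Qed.

(** Sending every transition letter to 1 turns exactly the words over transitions into numerals, and
    numerals are recognized by one equation. *)
Let collapse := recode (fun=> 1) (iota 0 N).

Let collapseP t : (exists n, collapse t = num n) <->
  exists2 w, t = word w & all (fun k => 0 < k <= N) w.
Proof.
have sub k : recode_letter (fun=> 1) (iota 0 N) k = if 0 < k <= N then 1 else k.
  by rewrite recode_letter_iota.
split=> [[n] /recode_word_inv[//|w -> e]|[w -> wN]]; last first.
  exists (size w); rewrite /collapse recode_word /num; congr word.
  apply: (@eq_from_nth _ 0) => [|i]; rewrite ?size_map ?size_nseq // => iw.
  by rewrite nth_nseq iw (nth_map 0) // sub (all_nthP 0 wN).
exists w => //; apply/allP => k kw.
have : recode_letter (fun=> 1) (iota 0 N) k \in nseq n 1 by rewrite e map_f.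
rewrite mem_nseq sub => /andP[_ /eqP]; case: ifP => // kN k1.
(* A letter outside the range is unchanged, hence equal to 1; but 1 lies in the range because [D] is
   nonempty. *)
by move: kN; rewrite k1 /N; case: (D) D0.
Qed.

(** In the formula, [z] is the run as a word of transitions, [b] the block of blanks and [c] the
    final queue. The equations say that [b] is a power of [B], that [z] uses transitions only, that
    the states chain up, and that what is written follows what is read. *)
Lemma queue_definable : definable (fun v : 'I_1 -> tree =>
  is_num (v ord0) /\ exists m u,
  qrun D p (F :: nseq (num_val (v ord0)) A ++ nseq m B) q u).
Proof.
apply: (@definable_ext _ (fun v => is_num (v ord0) /\ exists z b c,
  is_num (collapse z) /\
  tree_subst b (letter 0) (Node (tgt B) (letter 0)) = Node (tgt B) b /\
  Node (tgt p) (proj dst z) =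
    tree_subst (proj src z) (letter 0) (Node (tgt q) (letter 0)) /\
  tree_subst (Node (tgt F) (tree_subst (tree_subst (v ord0) (letter 1) (tgt A)) (letter 0) b))
     (letter 0) (proj wr z) = tree_subst (proj rd z) (letter 0) c)); last first.
  apply: definable_and; first by apply: definable_num; solve_definable.
  do 3!apply: definable_ex.
  have def_proj f n (G : ('I_n -> tree) -> tree) :
      term_definable G -> term_definable (fun v => proj f (G v)).
    exact: term_definable_recode.
  apply: definable_and.
    by apply/definable_num/term_definable_recode/term_definable_var.
  by do ![apply: definable_and | apply: definable_eq | apply: def_proj
    | apply: term_definable_cst | apply: term_definable_var
    | apply: term_definable_subst | apply: term_definable_node].
move=> v; split=> -[/is_numP-> H]; rewrite ?numK in H *;
  (split; first by apply/is_numP; rewrite numK).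
  have [z [b [c [/num_wordP/collapseP[w -> wN] [/unaryP]]]]] := H.
  move=> [//|m ->] []; rewrite !proj_word // => /chainP chain /shiftP[u e _].
  exists m; apply/qrunP => //; exists [seq nth (0, 0, 0, 0) D k.-1 | k <- w]; split=> //.
    by move=> _ /mapP[k /(allP wN) kN ->]; apply: mem_nth; rewrite -/N; lia.
  by exists u.
have [m /qrunP[//|z [zD chain [u e]]]] := H.
pose w := [seq (index t D).+1 | t <- z].
have wN : all (fun k => 0 < k <= N) w.
  by apply/allP => _ /mapP[t tz ->]; rewrite /= /N index_mem zD.
have wz : [seq nth (0, 0, 0, 0) D k.-1 | k <- w] = z.
  by rewrite -map_comp map_id_in // => t tz /=; rewrite nth_index // zD.
exists (word w), (word (nseq m (g B))), (word (map g u)); split; last split.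
- by apply/num_wordP/collapseP; exists w.
- by apply/unaryP => //; exists m.
- by rewrite !proj_word // wz; split; [apply/chainP|apply/shiftP; exists u].
Qed.

End QueueDefinable.

(** * Register machines *)

(* [j] is the next address, except that [IDec r j z] goes to [z] when register
   [r] is zero.  The machine halts at addresses outside the program. *)
Inductive instr := IInc (r j : nat) | IDec (r j z : nat).

Definition ireg i := match i with IInc r _ => r | IDec r _ _ => r end.

Definition upd (s : nat -> nat) r v : nat -> nat := fun k => if k == r then v else s k.

Definition istep i (s : nat -> nat) : nat * (nat -> nat) :=
  match i with
  | IInc r j => (j, upd s r (s r).+1)
  | IDec r j z => if s r is n.+1 then (j, upd s r n) else (z, s)
  end.

Definition fetch (P : seq instr) i := nth (IInc 0 0) P i.

Inductive mrun (P : seq instr) : nat -> (nat -> nat) -> nat -> (nat -> nat) -> Prop :=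
| MStop i s : mrun P i s i s
| MStep i s j s' : i < size P ->
    mrun P (istep (fetch P i) s).1 (istep (fetch P i) s).2 j s' -> mrun P i s j s'.

Lemma mrun_trans P i s j s' k s'' :
  mrun P i s j s' -> mrun P j s' k s'' -> mrun P i s k s''.
Proof. by elim=> // {}i {}s {}j {}s' iP _ IH /IH; apply: MStep. Qed.

Lemma mrun_rstep P i s j s' : mrun P i s j s' -> j < size P ->
  mrun P i s (istep (fetch P j) s').1 (istep (fetch P j) s').2.
Proof. by move=> run jP; apply: mrun_trans run _; apply: MStep => //; constructor. Qed.

(** Steps are deterministic and none is possible outside the program. *)
Lemma mrun_halt P i s j s' k s'' : mrun P i s j s' -> mrun P i s k s'' ->
  size P <= j -> size P <= k -> j = k.
Proof.
move=> run1 run2 jP kP; elim: run1 run2 jP => {i s j s'} [i s|i s j s' iP _ IH] run2 jP.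
  by inversion run2 => //; lia.
by inversion run2; subst; [lia|apply: IH].
Qed.

(* The queue holds a mark 0, the letter [r + 2] as many times as the value of
   register [r], and blanks 1.  Address [i] is state [2i]; state [2i + 1] scans
   for a letter to be decremented after the mark has been seen. *)
Definition symbols (P : seq instr) := [:: 0, 1, 2 & [seq (ireg i).+2 | i <- P]].

Definition copies p cs : seq transition := [seq (p, c, c, p) | c <- cs].

(** An increment rotates the queue until a blank turns up and overwrites it. A decrement rotates to
    the mark and then scans: the letter [r.+2], if found, becomes a blank, while meeting the mark
    again shows that the register is zero. *)
Definition itrans (syms : seq nat) i ins : seq transition :=
  match ins with
  | IInc r j =>
      (i.*2, 1, r.+2, j.*2) :: copies i.*2 [seq c <- syms | c != 1]
  | IDec r j z =>
      [:: (i.*2, 0, 0, i.*2.+1), (i.*2.+1, 0, 0, z.*2), (i.*2.+1, r.+2, 1, j.*2) &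
         copies i.*2 [seq c <- syms | c != 0] ++
         copies i.*2.+1 [seq c <- syms | (c != 0) && (c != r.+2)]]
  end.

Definition mtrans P := flatten [seq itrans (symbols P) i (fetch P i) | i <- iota 0 (size P)].

Lemma mtransP P t :
  reflect (exists2 i, i < size P & t \in itrans (symbols P) i (fetch P i)) (t \in mtrans P).
Proof.
apply: (iffP flatten_mapP) => [[i]|[i iP ti]]; first by rewrite mem_iota => iP; exists i.
by exists i; rewrite ?mem_iota.
Qed.

Lemma mem_copies t p cs : (t \in copies p cs) =
  [&& t == (p, rd t, rd t, p) & rd t \in cs].
Proof.
apply/mapP/andP => [[c cin ->]|[/eqP-> tin]]; first by rewrite eqxx.
by exists (rd t).
Qed.

Definition represents P (u : seq nat) (s : nat -> nat) :=
  [/\ {subset u <= symbols P}, count_mem 0 u = 1 & forall r, count_mem r.+2 u = s r].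

Lemma qrun_trans D p u q v r w : qrun D p u q v -> qrun D q v r w -> qrun D p u r w.
Proof. by elim=> // {}p a b p' {}u {}q {}v tD _ IH /IH; apply: QStep. Qed.

Lemma qrun_rotate D p v w : {in v, forall c, (p, c, c, p) \in D} ->
  qrun D p (v ++ w) p (w ++ v).
Proof.
elim: v w => [|c v IH] w vD; first by rewrite cats0; constructor.
apply: (QStep (b := c) (p' := p)); first by rewrite vD ?inE ?eqxx.
rewrite rcons_cat -cat_rcons; apply: IH => d dv.
by apply: vD; rewrite inE dv orbT.
Qed.

Lemma split_first (c : nat) u : c \in u -> exists v w, u = v ++ c :: w /\ c \notin v.
Proof.
move=> cu; exists (take (index c u) u), (drop (index c u).+1 u).
rewrite -{2}(nth_index c cu) -drop_nth ?index_mem // cat_take_drop.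
split=> //; apply/negP => /index_ltn.
by rewrite ltnn.
Qed.

Lemma mtrans_copy P i c : i < size P -> c \in symbols P ->
  match fetch P i with
  | IInc r j => c != 1 -> (i.*2, c, c, i.*2) \in mtrans P
  | IDec r j z =>
     (c != 0 -> (i.*2, c, c, i.*2) \in mtrans P) /\
     (c != 0 -> c != r.+2 -> (i.*2.+1, c, c, i.*2.+1) \in mtrans P)
  end.
Proof.
move=> iP cP; case e: (fetch P i) => [r j|r j z]; last split.
- move=> c1; apply/mtransP; exists i => //; rewrite e in_cons mem_copies mem_filter.
  by rewrite /rd /= eqxx c1 cP orbT.
- move=> c0; apply/mtransP; exists i => //; rewrite e 3!in_cons mem_cat !mem_copies !mem_filter.
  by rewrite /rd /= eqxx c0 cP !orbT.
- move=> c0 cr; apply/mtransP; exists i => //; rewrite e 3!in_cons mem_cat !mem_copies !mem_filter.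
  by rewrite /rd /= eqxx c0 cr cP !orbT.
Qed.

Lemma ireg_symbols P i : i < size P -> (ireg (fetch P i)).+2 \in symbols P.
Proof.
move=> iP; rewrite !inE; apply/orP; right; apply/orP; right; apply/orP; right.
by rewrite -(nth_map _ 0 (fun ins => (ireg ins).+2) iP) mem_nth ?size_map.
Qed.

(** One instruction uses up at most one blank, so a run succeeds if the queue starts with at least
    as many blanks as the run has steps. *)
Lemma simulate_step P i s u : i < size P -> represents P u s -> 1 \in u ->
  exists2 v, qrun (mtrans P) i.*2 u (istep (fetch P i) s).1.*2 v &
    represents P v (istep (fetch P i) s).2 /\ count_mem 1 u <= (count_mem 1 v).+1.
Proof.
move=> iP [uP u0 us] u1; have := ireg_symbols iP; have cpy := mtrans_copy iP.
case e: (fetch P i) cpy => [r j|r j z] cpy /= rP.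
  have [v [w [eu v1]]] := split_first u1; rewrite eu in uP u0 us u1 *.
  exists (rcons (w ++ v) r.+2); last split.
  - apply: qrun_trans (qrun_rotate _ _) _ => [c cv|].
      by apply: cpy; [rewrite uP // mem_cat cv|apply: contraNneq v1 => <-].
    apply: (QStep (p' := j.*2)) (QStop _ _ _).
    by apply/mtransP; exists i => //; rewrite e inE eqxx.
  - split=> [c||r'].
    + rewrite mem_rcons inE mem_cat => /orP[/eqP->//|cwv]; apply: uP.
      by rewrite mem_cat inE orbCA orbC; case/orP: cwv => ->; rewrite ?orbT.
    + by move: u0; rewrite -cats1 !count_cat /=; lia.
    + move: (us r'); rewrite /upd -cats1 !count_cat /= !eqSS eq_sym; case: eqP => [->|_]; lia.
  - by rewrite -cats1 !count_cat /=; lia.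
have [|v [w [eu v0]]] := @split_first 0 u; first by rewrite -has_pred1 has_count u0.
rewrite eu in uP u0 us u1 *.
(* First phase of a decrement: rotate to the mark and put it at the end, so that one pass over the
   rest [w ++ v] will decide whether the register is zero. *)
have run1 : qrun (mtrans P) i.*2 (v ++ 0 :: w) i.*2.+1 (rcons (w ++ v) 0).
  apply: qrun_trans (qrun_rotate _ _) _ => [c cv|].
    by apply: (cpy c _).1; [rewrite uP // mem_cat cv|apply: contraNneq v0 => <-].
  apply: (QStep (p' := i.*2.+1)) (QStop _ _ _).
  by apply/mtransP; exists i => //; rewrite e !inE eqxx ?orbT.
have wv0 : 0 \notin w ++ v.
  by rewrite -has_pred1 has_count; move: u0; rewrite !count_cat /=; lia.
have wvP : {subset w ++ v <= symbols P}.
  by move=> c; rewrite mem_cat => /orP[] cin; rewrite uP // mem_cat inE cin ?orbT.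
have us' r' : count_mem r'.+2 (w ++ v) = s r'.
  by rewrite -us !count_cat /=; lia.
have u1' : count_mem 1 (v ++ 0 :: w) = count_mem 1 (w ++ v).
  by rewrite !count_cat /=; lia.
have wv0' : count_mem 0 (w ++ v) = 0.
  by apply/eqP; rewrite -leqn0 leqNgt -has_count has_pred1.
rewrite u1'; move: (w ++ v) wv0 wvP us' run1 wv0' {u1' us u1 uP u0} => {eu v0}x x0 xP xs run1 cx0.
case: (boolP (r.+2 \in x)) => [/split_first[v' [w' [ex v'r]]]|xr]; last first.
  have -> /= : s r = 0 by rewrite -xs; apply/eqP; rewrite -leqn0 leqNgt -has_count has_pred1.
  exists (rcons x 0); last split.
  - apply: qrun_trans run1 _; rewrite -cats1.
    apply: qrun_trans (qrun_rotate _ _) _ => [c cx|].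
      by apply: (cpy c _).2; rewrite ?xP //; [apply: contraNneq x0|apply: contraNneq xr] => <-.
    rewrite cats1; apply: (QStep (p' := z.*2)) (QStop _ _ _).
    by apply/mtransP; exists i => //; rewrite e !inE eqxx ?orbT.
  - split=> [c||r'].
    + by rewrite mem_rcons inE => /orP[/eqP->|/xP].
    + by rewrite -cats1 count_cat cx0.
    + by rewrite -cats1 count_cat xs /= !addn0.
  - by rewrite -cats1 count_cat /=; lia.
have : 0 < s r by rewrite -xs -has_count has_pred1 ex mem_cat inE eqxx orbT.
case sr : (s r) => [//|n] _ /=; rewrite ex in xP xs x0 cx0 run1 *.
exists (rcons (rcons w' 0 ++ v') 1); last split.
- apply: qrun_trans run1 _; rewrite rcons_cat rcons_cons.
  apply: qrun_trans (qrun_rotate _ _) _ => [c cv|].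
    apply: (cpy c _).2; rewrite ?xP ?mem_cat ?cv //; last by apply: contraNneq v'r => <-.
    by apply: contraNneq x0 => <-; rewrite mem_cat cv.
  apply: (QStep (p' := j.*2)) (QStop _ _ _).
  by apply/mtransP; exists i => //; rewrite e !inE eqxx ?orbT.
- split=> [c||r'].
  + rewrite mem_rcons inE mem_cat mem_rcons inE => /orP[/eqP->//|/orP[/orP[/eqP->//|]|]] cin.
      by rewrite xP // mem_cat inE cin ?orbT.
    by rewrite xP // mem_cat cin.
  + by move: cx0; rewrite -!cats1 !count_cat /=; lia.
  + move: (xs r'); rewrite /upd -!cats1 !count_cat /= !eqSS [r == _]eq_sym.
    by case: eqP => [->|_]; lia.
- by rewrite -!cats1 !count_cat /=; lia.
Qed.

Lemma simulate P i s j s' : mrun P i s j s' -> exists M, forall u,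
  represents P u s -> M <= count_mem 1 u -> exists v, qrun (mtrans P) i.*2 u j.*2 v.
Proof.
elim=> {i s j s'} [i s|i s j s' iP _ [M IH]].
  by exists 0 => u _ _; exists u; constructor.
exists M.+1 => u us Mu; have [|v run [vs uv]] := simulate_step iP us.
  by rewrite -has_pred1 has_count; apply: leq_trans Mu.
have [|w run'] := IH v vs; first by rewrite -ltnS; apply: leq_trans uv.
by exists w; apply: qrun_trans run run'.
Qed.

(** What stands behind the mark has been read in the scanning state [i.*2.+1], where [r.+2] is not
    copied. *)
Definition scanned P i (u : seq nat) := exists r j z, fetch P i = IDec r j z /\
  exists x y, u = x ++ 0 :: y /\ r.+2 \notin y.

Definition simulates P i0 s0 p u := exists i s,
  [/\ mrun P i0 s0 i s, count_mem 0 u = 1, forall r, count_mem r.+2 u = s r &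
    p = i.*2 \/ p = i.*2.+1 /\ i < size P /\ scanned P i u].

(** Copying preserves the letter counts, and each other transition either starts a scan or carries
    out a machine step. The invariant [scanned] is what justifies the jump taken on a zero
    register. *)
Lemma simulates_step P i0 s0 p a b p' u : (p, a, b, p') \in mtrans P ->
  simulates P i0 s0 p (a :: u) -> simulates P i0 s0 p' (rcons u b).
Proof.
move=> /mtransP[k kP tk] [i [s [run u0 us pi]]].
have ki : p = k.*2 \/ p = k.*2.+1 -> k = i.
  by case: pi => [->|[-> _]] [] e; lia.
have same c : count_mem c (rcons u a) = count_mem c (a :: u).
  by rewrite -cats1 count_cat /= addn0 addnC.
have stay : p = i.*2 -> p' = p -> b = a -> simulates P i0 s0 p' (rcons u b).
  by move=> pe -> ->; exists i, s; split=> // [|r|]; rewrite ?same //; left.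
case e : (fetch P k) tk => [r j|r j z]; rewrite /itrans.
  rewrite in_cons mem_copies => /orP[/eqP[pk ea eb ep]|/andP[/eqP[pk eb ep] _]]; last first.
    have ik := ki (or_introl pk); rewrite ik in pk ep.
    by apply: stay => //; rewrite ep.
  have ik := ki (or_introl pk); subst.
  exists j, (upd s r (s r).+1); split=> [|| r'|]; last by left.
  - by have := mrun_rstep run kP; rewrite e.
  - by move: u0; rewrite -cats1 count_cat /=; lia.
  - move: (us r'); rewrite /upd -cats1 !count_cat /= !eqSS eq_sym; case: eqP => [->|_]; lia.
rewrite 3!in_cons mem_cat !mem_copies =>
  /or4P[/eqP[pk ea eb ep]|/eqP[pk ea eb ep]|/eqP[pk ea eb ep]|].
- have ik := ki (or_introl pk); subst.
  exists i, s; split=> // [|r'|]; rewrite ?same //; right; split=> //; split=> //.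
  exists r, j, z; split=> //; exists u, [::]; by rewrite cats1.
- have ik := ki (or_intror pk); subst.
  case: pi => [|[_ [_ [r' [j' [z' []]]]]]]; first by lia.
  rewrite e => -[<- _ _] [x [y [exy ry]]].
  (* The mark occurs only once, so it is the one at the front and the whole remaining queue has been
     scanned. *)
  have x0 : x = [::].
    case: x exy => // c x [<- eu]; move: u0; rewrite eu /= count_cat /=; lia.
  move: exy; rewrite x0 => -[uy].
  have sr : s r = 0.
    by rewrite -us /= add0n uy; apply/eqP; rewrite -leqn0 leqNgt -has_count has_pred1.
  exists z, s; split=> // [|||]; last by left.
  + by have := mrun_rstep run kP; rewrite e /= sr.
  + by rewrite same.
  + by move=> r''; rewrite same.
- have ik := ki (or_intror pk); subst.
  have : 0 < s r by rewrite -us /= eqxx.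
  case sr : (s r) => [//|n] _.
  exists j, (upd s r n); split=> // [||r'|]; last by left.
  + by have := mrun_rstep run kP; rewrite e /= sr.
  + by move: u0; rewrite -cats1 count_cat /=; lia.
  + move: (us r'); rewrite /upd -cats1 !count_cat /= !eqSS eq_sym; case: eqP => [->|_]; lia.
case/orP => /andP[/eqP[pk eb ep]].
  have ik := ki (or_introl pk); rewrite ik in pk ep.
  by move=> _; apply: stay => //; rewrite ep.
rewrite mem_filter => /andP[/andP[a0 ar] _]; have {}eb : b = a := eb.
have ik := ki (or_intror pk); subst.
exists i, s; split=> // [|r'|]; rewrite ?same //; right; split=> //; split=> //.
case: pi => [|[_ [_ [r' [j' [z' []]]]]]]; first by lia.
rewrite e => -[<- _ _] [x [y [exy ry]]]; exists r, j, z; split=> //.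
case: x exy => [[/eqP]|c x [_ ->]]; first by rewrite (negbTE a0).
exists x, (rcons y a); rewrite rcons_cat rcons_cons; split=> //.
by rewrite mem_rcons inE negb_or eq_sym ar.
Qed.

Lemma simulates_run P i s p u q v : qrun (mtrans P) p u q v ->
  simulates P i s p u -> simulates P i s q v.
Proof. by elim=> // {}p a b p' {}u {}q {}v tD _ IH /(simulates_step tD). Qed.

(** The final state is even, so by parity the automaton is not in the middle of a scan and the
    address can be read off. *)
Lemma simulate_inv P i s j u v :
  count_mem 0 u = 1 -> (forall r, count_mem r.+2 u = s r) ->
  qrun (mtrans P) i.*2 u j.*2 v -> exists s', mrun P i s j s'.
Proof.
move=> u0 us run.
have init : simulates P i s i.*2 u by exists i, s; split=> //; [constructor|left].
have [k [s' [run' _ _ [e|[e _]]]]] := simulates_run run init; last by lia.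
have -> : j = k by lia.
by exists s'.
Qed.

(** * Recursive functions *)

(* [Loop r c] is [while r > 0 do (r := r - 1; c)]. *)
Inductive cmd := Inc (r : nat) | Clear (r : nat) | Seq (c d : cmd) | Loop (r : nat) (c : cmd).

Inductive exec : cmd -> (nat -> nat) -> (nat -> nat) -> Prop :=
| EInc r s : exec (Inc r) s (upd s r (s r).+1)
| EClear r s : exec (Clear r) s (upd s r 0)
| ESeq c d s s' s'' : exec c s s' -> exec d s' s'' -> exec (Seq c d) s s''
| ELoop0 r c s : s r = 0 -> exec (Loop r c) s s
| ELoopS r c s n s' s'' : s r = n.+1 -> exec c (upd s r n) s' ->
    exec (Loop r c) s' s'' -> exec (Loop r c) s s''.

Lemma exec_eq c s s' s'' : exec c s s' -> s' = s'' -> exec c s s''.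
Proof. by move=> H <-. Qed.

Fixpoint csize c := match c with
  | Inc _ | Clear _ => 1
  | Seq c d => csize c + csize d
  | Loop _ c => (csize c).+1
  end.

(** The code is placed from address [p] on and exits to [q]. Clearing is a decrement that jumps to
    itself, and the body of a loop exits to the test at [p]. *)
Fixpoint compile c p q : seq instr := match c with
  | Inc r => [:: IInc r q]
  | Clear r => [:: IDec r p q]
  | Seq c d => compile c p (p + csize c) ++ compile d (p + csize c) q
  | Loop r c => IDec r p.+1 q :: compile c p.+1 p
  end.

Lemma size_compile c p q : size (compile c p q) = csize c.
Proof. by elim: c p q => //= [c IHc d IHd|r c IH] p q; rewrite ?size_cat ?IHc ?IHd ?IH. Qed.

Lemma upd_id s r v : v = s r -> upd s r v = s.
Proof.
move=> ->; apply: functional_extensionality => k.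
by rewrite /upd; case: eqP => [->|].
Qed.

Lemma upd_upd s r v w : upd (upd s r v) r w = upd s r w.
Proof. by apply: functional_extensionality => k; rewrite /upd; case: eqP. Qed.

Lemma upd_self s r v : upd s r v r = v.
Proof. by rewrite /upd eqxx. Qed.

Lemma upd_other s r v k : k != r -> upd s r v k = s k.
Proof. by rewrite /upd => /negbTE->. Qed.

Lemma fetch_mid P0 i P1 : fetch (P0 ++ i :: P1) (size P0) = i.
Proof. by rewrite /fetch nth_cat ltnn subnn. Qed.

Lemma compile_run c s s' : exec c s s' -> forall p q P0 P1, size P0 = p ->
  mrun (P0 ++ compile c p q ++ P1) p s q s'.
Proof.
elim=> {c s s'} [r s|r s|c d s s' s'' _ IHc _ IHd|r c s sr|r c s n s' s'' sr _ IHc _ IHl]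
  p q P0 P1 <- {p} /=.
- by apply: MStep; rewrite ?fetch_mid; [rewrite size_cat /=; lia|constructor].
- move sr: (s r) => n; elim: n s sr => [|n IH] s sr.
    apply: MStep; rewrite ?fetch_mid /= ?sr; first by rewrite size_cat /=; lia.
    by rewrite upd_id //; constructor.
  apply: MStep; rewrite ?fetch_mid /= ?sr; first by rewrite size_cat /=; lia.
  by have := IH _ (upd_self s r n); rewrite upd_upd.
- rewrite -catA; apply: mrun_trans (IHc _ _ _ _ erefl) _.
  by rewrite catA; apply: IHd; rewrite size_cat size_compile.
- apply: MStep; rewrite ?fetch_mid /= ?sr; last by constructor.
  by rewrite size_cat /=; lia.
- apply: MStep; rewrite ?fetch_mid /= ?sr; first by rewrite size_cat /=; lia.
  apply: mrun_trans (IHl _ _ _ _ erefl) => /=.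
  rewrite -cat_rcons; apply: IHc.
  by rewrite size_rcons.
Qed.

Ltac upd_at := rewrite /upd; repeat (case: eqP => ?; try (exfalso; lia)); try lia.

Ltac upd_tac := apply: functional_extensionality => ?; rewrite /upd;
  repeat (case: eqP => ?; try (exfalso; lia)); subst; try lia.

Definition move a t := Loop a (Inc t).

Lemma exec_move a t s : a != t ->
  exec (move a t) s (upd (upd s a 0) t (s t + s a)).
Proof.
move=> at_; move sa: (s a) => n; elim: n s sa => [|n IH] s sa.
  by apply: exec_eq (ELoop0 _ sa) _; upd_tac; lia.
apply: (ELoopS sa (EInc _ _)); apply: exec_eq (IH _ _) _.
  by rewrite upd_other // upd_self.
have ta : t == a = false by rewrite eq_sym (negbTE at_).
by apply: functional_extensionality => j; rewrite /upd ta; do 2!case: eqP => //; subst; lia.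
Qed.

(** Moving destroys its source, so [a] is first emptied into [t] and then restored while [b] is
    increased. *)
Definition copy a b t := Seq (Loop a (Inc t)) (Loop t (Seq (Inc a) (Inc b))).

Lemma exec_copy a b t s : a != t -> b != t -> a != b -> s t = 0 ->
  exec (copy a b t) s (upd s b (s b + s a)).
Proof.
move=> at_ bt ab st; apply: ESeq (exec_move _ at_) _; rewrite st add0n.
suff H n s' : s' t = n -> exec (Loop t (Seq (Inc a) (Inc b))) s'
    (upd (upd (upd s' t 0) a (s' a + n)) b (s' b + n)).
  apply: exec_eq (H (s a) _ _) _; first by rewrite upd_self.
  rewrite /upd !eqxx (negbTE at_) (negbTE bt) [b == a]eq_sym (negbTE ab).
  apply: functional_extensionality => j; case: (j =P b) => // _.
  by case: (j =P a) => [->//|_]; case: (j =P t) => [->|].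
elim: n s' => [|n IH] s' sn.
  by apply: exec_eq (ELoop0 _ sn) _; rewrite !addn0; upd_tac.
apply: (ELoopS sn (ESeq (EInc _ _) (EInc _ _))); apply: exec_eq (IH _ _) _.
  by rewrite /upd eqxx !(eq_sym t) (negbTE at_) (negbTE bt).
rewrite /upd !eqxx (negbTE at_) (negbTE bt) [b == a]eq_sym (negbTE ab).
apply: functional_extensionality => j.
by do !case: eqP => //; lia.
Qed.

(** The semantics unfolds from the last value downwards; the sequence [Z] of all values lets the
    compiled loop be followed upwards. *)
Lemma RPrec_seq n (g : recfun n) (h : recfun n.+2) x y : reval (RPrec g h) x y ->
  exists Z : nat -> nat, [/\ reval g (fun i => x (lift ord0 i)) (Z 0),
    forall i, i < x ord0 ->
      reval h (insert ord0 (Z i) (insert ord0 i (fun i => x (lift ord0 i)))) (Z i.+1) &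
    Z (x ord0) = y].
Proof.
rewrite /=; move: (x ord0) y; elim=> [|m IH] y; first by move=> gy; exists (fun=> y).
move=> [z [/IH[Z [Z0 ZS Zm]] hy]].
exists (fun i => if i == m.+1 then y else Z i); split=> [//|i|]; last by rewrite eqxx.
rewrite ltnS eqSS leq_eqVlt => /orP[/eqP->|im]; first by rewrite eqxx ltn_eqF // Zm.
by rewrite (ltn_eqF im) (ltn_eqF (leqW im)); apply: ZS.
Qed.

Lemma comp_insert A n (s : nat -> A) (k : 'I_n.+1) a (v : 'I_n -> nat) :
  (fun i => s (insert k a v i)) = insert k (s a) (fun i => s (v i)).
Proof. by apply: functional_extensionality => i; rewrite /insert; case: unlift. Qed.

(* [rcompile f inp out k] stores the value of [f] at the registers [inp] in the
   register [out], assuming that [out] and the scratch registers from [k] on are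
   zero, and leaves the latter zero. *)
Fixpoint rcompile n (f : recfun n) (inp : 'I_n -> nat) (out k : nat) {struct f} : cmd :=
  match f in recfun m return ('I_m -> nat) -> cmd with
  | RZero _ => fun inp => Clear out
  | RSucc => fun inp => Seq (copy (inp ord0) out k) (Inc out)
  | RProj _ i => fun inp => copy (inp i) out k
  | RComp m _ g h => fun inp =>
      Seq (foldr (fun i c => Seq (rcompile (h i) inp (k + i) (k + m)) c) (Clear out) (enum 'I_m))
     (Seq (rcompile g (fun i => k + i) out (k + m))
          (foldr (fun i => Seq (Clear (k + i))) (Clear (k + m)) (iota 0 m)))
  | RPrec _ g h => fun inp =>
      let p := fun i => inp (lift ord0 i) in
      Seq (rcompile g p k (k + 4))
     (Seq (copy (inp ord0) k.+1 (k + 3))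
     (Seq (Loop k.+1
            (Seq (rcompile h (insert ord0 k (insert ord0 (k + 2) p)) (k + 3) (k + 4))
            (Seq (Clear k) (Seq (move (k + 3) k) (Inc (k + 2))))))
     (Seq (move k out) (Clear (k + 2)))))
  | RMu _ g => fun inp =>
      Seq (Inc k)
          (Loop k
            (Seq (rcompile g (insert ord0 out inp) k.+1 (k + 2))
                 (Loop k.+1 (Seq (Clear k.+1) (Seq (Inc k) (Inc out))))))
  end inp.

Lemma insert_all A n (P : A -> Prop) (k : 'I_n.+1) a v :
  P a -> (forall i, P (v i)) -> forall i, P (insert k a v i).
Proof. by move=> Pa Pv i; rewrite /insert; case: unlift. Qed.

(** Layout of the registers: composition keeps the arguments in [k + i]; recursion keeps the current
    value in [k], a countdown in [k.+1], the predecessor in [k + 2] and the new value in [k + 3];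
    minimization keeps a flag in [k], the value of [g] in [k.+1] and the candidate in [out]. *)
Lemma rcompile_exec n (f : recfun n) inp out k s y :
  reval f (fun i => s (inp i)) y -> (forall i, inp i < k) -> out < k ->
  (forall i, inp i != out) -> s out = 0 -> (forall r, k <= r -> s r = 0) ->
  exec (rcompile f inp out k) s (upd s out y).
Proof.
elim: f inp out k s y => {n} [n||n i|m n g IHg h IHh|n g IHg h IHh|n g IHg]
  inp out k s y /=.
- by move=> -> *; apply: EClear.
- move=> -> inpk outk io so sk; apply: ESeq (exec_copy _ _ _ _) _.
  + by rewrite neq_ltn inpk.
  + by rewrite neq_ltn outk.
  + exact: io.
  + exact: sk.
  by apply: exec_eq (EInc _ _) _; rewrite upd_self upd_upd so.
- move=> -> inpk outk io so sk; apply: exec_eq (exec_copy _ _ _ _) _.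
  + by rewrite neq_ltn inpk.
  + by rewrite neq_ltn outk.
  + exact: io.
  + exact: sk.
  by rewrite so.
- move=> [z [hz gz]] inpk outk io so sk.
  pose Z j := oapp z 0 (insub j).
  have Zz i : Z (val i) = z i by rewrite /Z valK.
  (* For the induction, [l] is the list of arguments still to be computed, and the state need only
     agree with [s] on the inputs. *)
  have run_args (l : seq 'I_m) s' : uniq l -> (forall i, s' (inp i) = s (inp i)) ->
      (forall i, i \in l -> s' (k + i) = 0) -> (forall r, k + m <= r -> s' r = 0) ->
      s' out = 0 ->
      exec (foldr (fun i c => Seq (rcompile (h i) inp (k + i) (k + m)) c) (Clear out) l)
        s' (fun r => if (k <= r) && (r - k \in map (@nat_of_ord m) l) then Z (r - k) else s' r).
    elim: l s' => [|i l IH] s' /=.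
      move=> _ _ _ _ so'; apply: exec_eq (EClear _ _) _; rewrite upd_id //.
      by apply: functional_extensionality => r; rewrite in_nil andbF.
    move=> /andP[il ul] si sl sm so'.
    have im := ltn_ord i.
    apply: ESeq; first apply: (IHh i _ _ _ _ (z i)).
    + by rewrite (_ : (fun i => s' (inp i)) = (fun i => s (inp i))) //;
        apply: functional_extensionality.
    + by move=> j; have := inpk j; lia.
    + by lia.
    + by move=> j; have := inpk j; lia.
    + by apply: sl; rewrite inE eqxx.
    + exact: sm.
    apply: exec_eq (IH _ ul _ _ _ _) _.
    + by move=> j; rewrite upd_other //; have := inpk j; lia.
    + move=> j jl; rewrite upd_other; first by apply: sl; rewrite inE jl orbT.
      apply: contraNneq il => e; suff -> : i = j by [].
      by apply: ord_inj; lia.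
    + by move=> r mr; rewrite upd_other ?sm //; lia.
    + by rewrite upd_other //; lia.
    apply: functional_extensionality => r; rewrite inE /upd.
    case: (boolP (r - k \in map (@nat_of_ord m) l)) => [_|_].
      by rewrite orbT; case: ifP => // kr; case: eqP => //; lia.
    rewrite andbF orbF; case: (r =P k + i) => [->|ne].
      by rewrite leq_addr addKn eqxx Zz.
    by case: ifP => // /andP[kr /eqP e]; case: ne; lia.
  have clear l s' : s' (k + m) = 0 ->
      exec (foldr (fun i => Seq (Clear (k + i))) (Clear (k + m)) l) s'
        (fun r => if (k <= r) && (r - k \in l) then 0 else s' r).
    elim: l s' => [|i l IH] s' /= sm.
      apply: exec_eq (EClear _ _) _; rewrite upd_id //.
      by apply: functional_extensionality => r; rewrite in_nil andbF.
    apply: ESeq (EClear _ _) _; apply: exec_eq (IH _ _) _.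
      by rewrite /upd; case: eqP.
    apply: functional_extensionality => r; rewrite inE /upd.
    case: (boolP (r - k \in l)) => [_|_];
      first by rewrite orbT; case: ifP => // kr; case: eqP => //; lia.
    rewrite andbF orbF; case: (r =P k + i) => [->|ne].
      by rewrite leq_addr addKn eqxx.
    by case: ifP => // /andP[kr /eqP e]; case: ne; lia.
  have := run_args (enum 'I_m) s (enum_uniq _) (fun=> erefl).
  rewrite (val_enum_ord m : map (@nat_of_ord m) _ = _) => run1.
  apply: ESeq (run1 _ _ so) _ => {run1 run_args} [i _|r mr|].
  + by apply: sk; lia.
  + by apply: sk; lia.
  apply: ESeq; first apply: (IHg _ _ _ _ y).
  + rewrite (_ : (fun i : 'I_m => _) = z) //; apply: functional_extensionality => i.
    by rewrite leq_addr addKn mem_iota ltn_ord /= Zz.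
  + by move=> i; have := ltn_ord i; lia.
  + by lia.
  + by move=> i; lia.
  + by case: ifP => //; lia.
  + by move=> r mr; rewrite mem_iota; case: ifP => [|_]; [lia|apply: sk; lia].
  apply: exec_eq (clear _ _ _) _.
    by rewrite upd_other ?mem_iota; [case: ifP => [|_]; [lia|apply: sk; lia]|lia].
  apply: functional_extensionality => r; rewrite /upd mem_iota.
  case: (r =P out) => [->|_]; first by case: ifP => //; lia.
  by case: ifP => [/andP[kr _]|->] //; rewrite sk.
- move=> /(@RPrec_seq _ g h (fun i => s (inp i)) y)[Z [Z0 ZS <-]] inpk outk io so sk.
  have sk0 : s k = 0 by apply: sk.
  have sk1 : s k.+1 = 0 by apply: sk.
  have sk2 : s (k + 2) = 0 by apply: sk; lia.
  have sk3 : s (k + 3) = 0 by apply: sk; lia.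
  have inp0 := inpk ord0; have io0 := io ord0.
  set p := fun i => inp (lift ord0 i); set X := s (inp ord0).
  have pk i : p i < k by apply: inpk.
  (* The state after [i] rounds with [c] rounds left; the loop leads from [S X 0] to [S 0 X], with
     [i + c = X] invariant. *)
  pose S c i := upd (upd (upd s k (Z i)) k.+1 c) (k + 2) i.
  apply: ESeq; first apply: (IHg _ _ _ _ _ Z0).
  + by move=> i; have := pk i; rewrite /p; lia.
  + by lia.
  + by move=> i; have := pk i; rewrite /p; lia.
  + exact: sk0.
  + by move=> r mr; apply: sk; lia.
  apply: ESeq; first apply: exec_copy; try lia.
    by rewrite upd_other //; lia.
  rewrite (_ : upd _ _ _ = S X 0); last by rewrite /S /X; upd_tac.
  apply: (ESeq (s' := S 0 X)); last first.
    apply: ESeq; first by apply: exec_move; lia.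
    by apply: exec_eq (EClear _ _) _; rewrite /S; upd_tac.
  suff : forall c i, i + c = X -> exec (Loop k.+1
    (Seq (rcompile h (insert ord0 k (insert ord0 (k + 2) p)) (k + 3) (k + 4))
    (Seq (Clear k) (Seq (move (k + 3) k) (Inc (k + 2)))))) (S c i) (S 0 X).
    by apply.
  elim=> [|c IH] i iX.
    rewrite addn0 in iX; rewrite iX; apply: ELoop0.
    by rewrite /S; upd_at.
  apply: (ELoopS (n := c)); last by apply: (IH i.+1); lia.
    by rewrite /S; upd_at.
  rewrite (_ : upd _ _ _ = S c i); last by rewrite /S; upd_tac.
  apply: ESeq; first apply: (IHh _ _ _ _ (Z i.+1)).
  + rewrite !comp_insert.
    rewrite (_ : S c i k = Z i); last by rewrite /S; upd_at.
    rewrite (_ : S c i (k + 2) = i); last by rewrite /S upd_self.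
    rewrite (_ : (fun j => S c i (p j)) = (fun j => s (inp (lift ord0 j)))).
      by apply: ZS; rewrite -/X; lia.
    by apply: functional_extensionality => j; rewrite /S !upd_other //; have := pk j; lia.
  + apply: (@insert_all _ _ (fun a => a < k + 4)); first lia.
    apply: (@insert_all _ _ (fun a => a < k + 4)); first lia.
    by move=> j; have := pk j; lia.
  + by lia.
  + apply: (@insert_all _ _ (fun a => a != k + 3)); first lia.
    apply: (@insert_all _ _ (fun a => a != k + 3)); first lia.
    by move=> j; have := pk j; lia.
  + by rewrite /S !upd_other //; lia.
  + by move=> r kr; rewrite /S !upd_other ?sk //; lia.
  apply: ESeq (EClear _ _) _; apply: ESeq; first by apply: exec_move; lia.
  by apply: exec_eq (EInc _ _) _; rewrite /S; upd_tac.
- move=> [g0 gS] inpk outk io so sk.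
  have sk0 : s k = 0 by apply: sk.
  have sk1 : s k.+1 = 0 by apply: sk.
  (* The state with candidate [z] and flag [b]; the search continues while the flag is 1. *)
  pose S z b := upd (upd s out z) k b.
  apply: ESeq (EInc _ _) _; rewrite (_ : upd _ _ _ = S 0 1); last by rewrite /S; upd_tac.
  have run_g z u : reval g (insert ord0 z (fun i => s (inp i))) u ->
      exec (rcompile g (insert ord0 out inp) k.+1 (k + 2)) (S z 0) (upd (S z 0) k.+1 u).
    move=> gu; apply: IHg.
    + rewrite comp_insert.
      rewrite (_ : S z 0 out = z); last by rewrite /S; upd_at.
      rewrite (_ : (fun j => S z 0 (inp j)) = (fun j => s (inp j))) //.
      apply: functional_extensionality => j; rewrite /S !upd_other //.
      by have := inpk j; lia.
    + by apply: (@insert_all _ _ (fun a => a < k + 2)); [lia|move=> j; have := inpk j; lia].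
    + by lia.
    + apply: (@insert_all _ _ (fun a => a != k.+1)); first lia.
      by move=> j; have := inpk j; lia.
    + by rewrite /S !upd_other //; lia.
    + by move=> r kr; rewrite /S !upd_other ?sk //; lia.
  suff : forall d z, z + d = y -> exec (Loop k
    (Seq (rcompile g (insert ord0 out inp) k.+1 (k + 2))
      (Loop k.+1 (Seq (Clear k.+1) (Seq (Inc k) (Inc out)))))) (S z 1) (upd s out y).
    by apply.
  elim=> [|d IH] z zd.
    rewrite addn0 in zd; rewrite zd; apply: (ELoopS (n := 0)); first by rewrite /S upd_self.
      rewrite (_ : upd _ _ _ = S y 0); last by rewrite /S upd_upd.
      by apply: ESeq (run_g _ _ g0) _; apply: ELoop0; rewrite upd_self.
    by apply: exec_eq (ELoop0 _ _) _; [|rewrite /S; upd_tac];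
      rewrite /S; upd_at.
  have [u gu] := gS z ltac:(lia).
  apply: (ELoopS (n := 0)); [by rewrite /S upd_self| |exact: (IH z.+1 ltac:(lia))].
  rewrite (_ : upd _ _ _ = S z 0); last by rewrite /S upd_upd.
  (* The inner loop serves as a conditional: its body clears the tested register, so it runs once
     when the value of [g] is positive, setting the flag again and advancing the candidate. *)
  apply: ESeq (run_g _ _ gu) _; apply: (ELoopS (n := u)); first by rewrite upd_self.
    by apply: ESeq (EClear _ _) _; apply: ESeq (EInc _ _) (EInc _ _).
  by apply: exec_eq (ELoop0 _ _) _; [|rewrite /S; upd_tac]; rewrite /S; upd_at.
Qed.

(** * Diagonalization *)

(** Reaching a fixed final state is what [queue_definable] expresses, so the test on the result is
    turned into a choice between two halting addresses. Each direction is one half of the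
    simulation, together with uniqueness of the halting address. *)
Lemma zero_test_definable (g : recfun 1) : exists p : eform bt_language 1,
  forall n y, reval g (fun=> n) y -> sat bt_structure p (fun=> num n) <-> y = 0.
Proof.
pose c := rcompile g (fun=> 0) 1 2; pose L := csize c.
(* Both exits of the last instruction lie outside the program: [L.+1] is reached when the output
   register 1 is zero, [L.+2] otherwise. *)
pose P := compile c 0 L ++ [:: IDec 1 L.+2 L.+1].
have sP : size P = L.+1 by rewrite size_cat size_compile addn1.
have fL : fetch P L = IDec 1 L.+2 L.+1.
  by rewrite /fetch nth_cat size_compile ltnn subnn.
have D0 : mtrans P != [::].
  have : (L.*2, 0, 0, L.*2.+1) \in mtrans P.
    by apply/mtransP; exists L; rewrite ?sP // fL /= inE eqxx.
  by case: (mtrans P).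
have [p pP] := queue_definable 0 L.+1.*2 2 1 0 D0; exists p => n y gy.
rewrite pP numK; set s := upd (fun=> 0) 0 n.
have run : mrun P 0 s L (upd s 1 y).
  apply: (@compile_run _ _ _ _ 0 L [::]) => //.
  by apply: rcompile_exec => // -[].
have {}run := mrun_rstep run (_ : L < size P).
rewrite sP fL /= upd_self in run.
have u0 m : count_mem 0 (0 :: nseq n 2 ++ nseq m 1) = 1.
  by rewrite /= count_cat !count_nseq.
have us m r : count_mem r.+2 (0 :: nseq n 2 ++ nseq m 1) = s r.
  by rewrite /= count_cat !count_nseq /s /upd; case: r => //=; lia.
split=> [[_ [m [u]]]|y0].
  move=> /(@simulate_inv _ 0 _ _ _ _ (u0 m) (us m))[s' run'].
  case: y run {gy} => // y run; have := mrun_halt (run (ltnSn _)) run'.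
  by rewrite sP => /(_ (leqnSn _) (leqnn _)) /=; lia.
rewrite y0 in run; split; first by apply/is_numP; rewrite numK.
have [M MP] := simulate (run (ltnSn _)); exists M.
have [|| u] := MP (0 :: nseq n 2 ++ nseq M 1); last by exists u.
  split=> // i; rewrite inE mem_cat !mem_nseq !inE.
  by case/or3P => [|/andP[_]|/andP[_]] ->; rewrite ?orbT.
by rewrite /= count_cat !count_nseq /=; lia.
Qed.

(** * Total recursive functions and codes of instances *)

Definition recursive n (F : ('I_n -> nat) -> nat) :=
  exists f : recfun n, forall x, reval f x (F x).

Lemma recursive_proj n (i : 'I_n) : recursive (fun x => x i).
Proof. by exists (RProj i). Qed.

Lemma recursive_comp1 n (G : nat -> nat) (F : ('I_n -> nat) -> nat) :
  recursive (fun x : 'I_1 -> nat => G (x ord0)) -> recursive F ->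
  recursive (fun x => G (F x)).
Proof.
move=> [g gP] [f fP]; exists (RComp g (fun=> f)) => x.
by exists (fun=> F x); split=> //; apply: gP.
Qed.

Lemma recursive_comp2 n (G : nat -> nat -> nat) (F F' : ('I_n -> nat) -> nat) :
  recursive (fun x : 'I_2 -> nat => G (x ord0) (x (lift ord0 ord0))) ->
  recursive F -> recursive F' -> recursive (fun x => G (F x) (F' x)).
Proof.
move=> [g gP] [f fP] [f' fP']; exists (RComp g (fun i => if val i == 0 then f else f')) => x.
exists (fun i => if val i == 0 then F x else F' x).
by split=> [[[|[]]]//|]; apply: gP.
Qed.

Lemma recursive_succ n (F : ('I_n -> nat) -> nat) :
  recursive F -> recursive (fun x => (F x).+1).
Proof. by apply: recursive_comp1; exists RSucc. Qed.

Lemma recursive_cst n c : recursive (fun _ : 'I_n -> nat => c).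
Proof. by elim: c => [|c]; [exists (RZero n)|apply: recursive_succ]. Qed.

Lemma recursive_prec n (F : nat -> ('I_n -> nat) -> nat) H :
  recursive (F 0) -> (forall m p, F m.+1 p = H (F m p) m p) ->
  recursive (fun w : 'I_n.+2 -> nat =>
    H (w ord0) (w (lift ord0 ord0)) (fun i => w (lift ord0 (lift ord0 i)))) ->
  recursive (fun x : 'I_n.+1 -> nat => F (x ord0) (fun i => x (lift ord0 i))).
Proof.
move=> [g gP] FS [h hP]; exists (RPrec g h) => x /=.
elim: (x ord0) => [|m IH]; first exact: gP.
exists (F m (fun i => x (lift ord0 i))); split=> //; rewrite FS.
move: (hP (insert ord0 (F m (fun i => x (lift ord0 i)))
   (insert ord0 m (fun i => x (lift ord0 i))))).
rewrite insert_lift !insert_ord0; congr reval; congr H.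
by apply: functional_extensionality => i; rewrite !insert_lift.
Qed.

Lemma recursive_add n (F G : ('I_n -> nat) -> nat) :
  recursive F -> recursive G -> recursive (fun x => F x + G x).
Proof.
apply: recursive_comp2.
apply: (@recursive_prec 1 (fun m p => m + p ord0) (fun z _ _ => z.+1)) => //.
  exact: recursive_proj.
exact/recursive_succ/recursive_proj.
Qed.

Lemma recursive_cpair n (F G : ('I_n -> nat) -> nat) :
  recursive F -> recursive G -> recursive (fun x => cpair (F x) (G x)).
Proof.
move=> FP GP; apply: recursive_add => //.
apply: (@recursive_comp1 _ (fun m => 'C(m.+1, 2))); last exact: recursive_add.
(* These are the triangular numbers, obtained by adding [m.+1] at each step. *)
apply: (@recursive_prec 0 (fun m _ => 'C(m.+1, 2)) (fun z m _ => z + m.+1)).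
- exact: recursive_cst.
- by move=> m _; rewrite binS bin1.
apply: recursive_add; first exact: recursive_proj.
exact/recursive_succ/recursive_proj.
Qed.

Lemma recursive_cons n (F : ('I_n -> nat) -> nat) (s : ('I_n -> nat) -> seq nat) :
  recursive F -> recursive (fun x => cseq (s x)) ->
  recursive (fun x => cseq (F x :: s x)).
Proof. by move=> FP sP; apply/recursive_succ/recursive_cpair. Qed.

Lemma tcode_node n (t u : term bt_language n) : tcode (node_term t u) =
  cseq [:: 2; val (enum_rank (BPair : Defs.fsym bt_language)); tcode t; tcode u].
Proof.
suff -> : [:: tcode t; tcode u] =
    [seq tcode (nth t [:: t; u] (val i)) | i : 'I_2 <- enum 'I_2] by [].
by rewrite (map_comp (fun i => tcode (nth t [:: t; u] i)) val) val_enum_ord.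
Qed.

Lemma recursive_num n (F : ('I_n -> nat) -> nat) :
  recursive F -> recursive (fun x => tcode (tree_term 1 (num (F x)))).
Proof.
apply: (@recursive_comp1 _ (fun m => tcode (tree_term 1 (num m)))).
apply: (@recursive_prec 0 (fun m _ => tcode (tree_term 1 (num m)))
  (fun z _ _ => cseq [:: 2; val (enum_rank (BPair : Defs.fsym bt_language));
     tcode (tree_term 1 (letter 1)); z])).
- exact: recursive_cst.
- by move=> m _; rewrite -tcode_node.
do 3!apply: recursive_cons (recursive_cst _ _) _.
apply: recursive_cons (recursive_proj _) _; exact: recursive_cst.
Qed.

(** The numeral is supplied by an equation under the quantifier instead of a substitution into [p],
    so that the code of [p] enters the code of the instance unchanged. *)
Definition instance (p : eform bt_language 1) m : eform bt_language 0 :=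
  FEx (FAnd (FEq (Var ord0) (tree_term 1 (num m))) p).

Definition instance_code a m := cseq [:: 6; cseq [:: 4;
  cseq [:: 0; tcode (Var ord0 : term bt_language 1); tcode (tree_term 1 (num m))]; a]].

Lemma recursive_instance : recursive (fun x : 'I_1 -> nat => instance_code (x ord0) (x ord0)).
Proof.
apply: recursive_cons; first exact: recursive_cst.
apply: recursive_cons; last exact: recursive_cst.
apply: recursive_cons; first exact: recursive_cst.
apply: recursive_cons; last first.
  by apply: recursive_cons; [apply: recursive_proj|apply: recursive_cst].
apply: recursive_cons; first exact: recursive_cst.
apply: recursive_cons; first exact: recursive_cst.
apply: recursive_cons; last exact: recursive_cst.
by apply/recursive_num/recursive_proj.
Qed.

Lemma true_instance p m :
  true_in bt_structure (instance p m) <-> sat bt_structure p (fun=> num m).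
Proof.
have ins (v : 'I_0 -> tree) : insert ord0 (num m) v = fun=> num m.
  by apply: functional_extensionality => i; rewrite [i]ord1 insert_ord0.
split=> [/(_ (fun=> Bot))|pm v] /=.
  by move=> [a []]; rewrite insert_ord0 teval_tree_term => ->; rewrite ins.
by exists (num m); rewrite ins teval_tree_term.
Qed.

(** * Injectivity of the coding, up to meaning *)

Lemma cpair_inj x y x' y' : cpair x y = cpair x' y' -> x = x' /\ y = y'.
Proof.
rewrite /cpair => e; have xy : x + y = x' + y'; last by rewrite xy in e; lia.
(* With sum [a] the code is at most ['C(a.+1, 2) + a], below every code with a larger sum; so the
   code determines the sum. *)
have lt a b : a < b -> 'C(a.+1, 2) + a < 'C(b.+1, 2).
  move=> ab; apply: (@leq_trans 'C(a.+2, 2)); last exact: leq_bin2l.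
  by rewrite (binS a.+1) bin1; lia.
case: (ltngtP (x + y) (x' + y')) => // /lt; move: e.
  by move: 'C(_, _) 'C(_, _) => *; lia.
by move: 'C(_, _) 'C(_, _) => *; lia.
Qed.

Lemma cseq_inj : injective cseq.
Proof. by elim=> [|x s IH] [|y t] //= [] /cpair_inj[-> /IH->]. Qed.

Lemma tcode_teval L A (M : structure L A) n (s t : term L n) v :
  tcode s = tcode t -> teval M v s = teval M v t.
Proof.
elim: s t => [i|c|f a IH] [j|d|g b] // /cseq_inj //.
- by case=> /val_inj->.
- by case=> /ord_inj/enum_rank_inj->.
case=> /ord_inj/enum_rank_inj fg; subst g => e.
congr ifun; apply: functional_extensionality => i; apply: IH.
by have /eq_in_map := e; apply; rewrite mem_enum.
Qed.

Lemma args_teval L A (M : structure L A) n v k (a b : 'I_k -> term L n) :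
  [seq tcode (a i) | i <- enum 'I_k] = [seq tcode (b i) | i <- enum 'I_k] ->
  forall i, teval M v (a i) = teval M v (b i).
Proof.
by move=> /eq_in_map e i; apply/tcode_teval/e; rewrite mem_enum.
Qed.

(** The decided set speaks of some sentence with the given code, so truth has to be transferred
    between sentences that share a code. *)
Lemma code_sat L A (M : structure L A) n (p q : eform L n) v :
  code p = code q -> sat M p v <-> sat M q v.
Proof.
elim: p q v => {n} [n s t|n s t|n r a|n r a|n p IHp q IHq|n p IHp q IHq|n p IH] p' v.
- case: n / p' s t v => n => [s' t'|s' t'|r' a'|r' a'|p' q'|p' q'|p'] s t v // /cseq_inj //=.
  by case=> /(tcode_teval M v)-> /(tcode_teval M v)->.
- case: n / p' s t v => n => [s' t'|s' t'|r' a'|r' a'|p' q'|p' q'|p'] s t v // /cseq_inj //=.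
  by case=> /(tcode_teval M v)-> /(tcode_teval M v)->.
- case: n / p' a v => n => [s' t'|s' t'|r' a'|r' a'|p' q'|p' q'|p'] a v // /cseq_inj //=.
  case=> /ord_inj/enum_rank_inj er; subst r' => /(args_teval M v) e.
  by rewrite (functional_extensionality _ _ e).
- case: n / p' a v => n => [s' t'|s' t'|r' a'|r' a'|p' q'|p' q'|p'] a v // /cseq_inj //=.
  case=> /ord_inj/enum_rank_inj er; subst r' => /(args_teval M v) e.
  by rewrite (functional_extensionality _ _ e).
- case: n / p' p q IHp IHq v => n
    => [s' t'|s' t'|r' a'|r' a'|p' q'|p' q'|p'] p q IHp IHq v // /cseq_inj //=.
  by case=> /(IHp _ v)-> /(IHq _ v)->.
- case: n / p' p q IHp IHq v => n
    => [s' t'|s' t'|r' a'|r' a'|p' q'|p' q'|p'] p q IHp IHq v // /cseq_inj //=.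
  by case=> /(IHp _ v)-> /(IHq _ v)->.
- case: n / p' p IH v => n => [s' t'|s' t'|r' a'|r' a'|p' q'|p' q'|p'] p IH v // /cseq_inj //=.
  by case=> e; split=> -[a sa]; exists a; apply/(IH _ (insert ord0 a v) e).
Qed.

Theorem theorem5 :
  ex_interpretable nat_structure bt_structure /\
  ~ decidable_ex_theory bt_structure.
Proof.
split; first exact: nat_interpretable.
move=> [f fP]; have [i iP] := recursive_instance.
(* The formula [p] says of [n] that the decision procedure [f] rejects the instance at [n] of the
   formula with code [n]. *)
have [p pP] := zero_test_definable (RComp f (fun=> i)).
(* Applied to its own code, [p] gives a sentence with code [c] that asserts its own rejection. *)
pose m := code p; pose c := code (instance p m).
have run b : reval f (fun=> c) b -> reval (RComp f (fun=> i)) (fun=> m) b.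
  by move=> fb; exists (fun=> c); split=> // _; apply: iP.
have [yes no] := fP c.
(* Were it true, [f] would answer 1 on [c], whereas its truth means that the answer is 0. *)
have not_true : ~ exists q : eform bt_language 0, true_in bt_structure q /\ code q = c.
  move=> Sc; have /run/pP pm := yes Sc; case: Sc => q [tq qc].
  have : sat bt_structure p (fun=> num m).
    by apply/true_instance => v; apply/(code_sat _ _ qc).
  by move/pm.
(* Being untrue, it is rejected by [f], and that is what it asserts. *)
apply: (not_true); exists (instance p m); split=> //.
by apply/true_instance/(pP _ _ (run _ (no not_true))).
Qed.
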